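(* Let $K\subset\mathbb{R}^d$ be a Lebesgue measurable set with positive and finite measure. Let $\Lambda = M(\mathbb{Z}^{2d})$, where $M$ is an invertible $2d\times 2d$ real lower triangular block matrix $$M=\begin{pmatrix} A & O\\ C & B\end{pmatrix},\qquad |\det(AB)|=1,$$ with $A,B,C$ real $d\times d$ matrices. Suppose that $\mathcal{G}(|K|^{-1/2}\chi_K,\Lambda)$ is a Gabor orthonormal basis for $L^2(\mathbb{R}^d)$. Then there exists an integer $N\ge 1$ such that, up to Lebesgue measure zero, $$K=\bigcup_{j=1}^N D_j=\bigcup_{j=1}^N E_j,$$ where each $D_j$ is a fundamental domain of $B^{-t}(\mathbb{Z}^d)$, each $E_j$ is a fundamental domain of $A(\mathbb{Z}^d)$, and $|D_i\cap D_j|=0$ and $|E_i\cap E_j|=0$ for all $i\neq j$. (That is, $K$ multi-tiles $\mathbb{R}^d$ simultaneously by $A(\mathbb{Z}^d)$ and by $B^{-t}(\mathbb{Z}^d)$, at level $N$.)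
   Context: $|K|$ denotes Lebesgue measure, $\chi_K$ the indicator function of $K$, and $B^{-t}$ the inverse transpose of $B$. For $g\in L^2(\mathbb{R}^d)$ and a countable set $\Lambda\subset\mathbb{R}^{2d}$, the Gabor system $\mathcal{G}(g,\Lambda)$ is the collection of functions $\pi(a,b)g(x)=e^{2\pi i\langle b,x\rangle}g(x-a)$, $(a,b)\in\Lambda$ (with $a,b\in\mathbb{R}^d$); it is a Gabor orthonormal basis if it is an orthonormal basis of $L^2(\mathbb{R}^d)$. A fundamental domain of a full-rank lattice $\Gamma\subset\mathbb{R}^d$ is a measurable set meeting every coset $x+\Gamma$ in exactly one point; as usual this is understood up to sets of Lebesgue measure zero. A measurable set $K$ multi-tiles $\mathbb{R}^d$ by a countable set $\mathcal{J}$ at level $N$ (integer $N\ge1$) if $\sum_{t\in\mathcal{J}}\chi_K(x+t)=N$ for a.e. $x\in\mathbb{R}^d$. *)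

(* Defs.v *)
From HB Require Import structures.
From mathcomp Require Import all_boot all_order all_algebra complex.
From mathcomp Require Import all_classical all_reals all_analysis.

Set Implicit Arguments.
Unset Strict Implicit.
Unset Printing Implicit Defensive.
Import Order.TTheory GRing.Theory Num.Theory.
Import numFieldNormedType.Exports.

Local Open Scope classical_set_scope.
Local Open Scope complex_scope.
Local Open Scope ring_scope.

Section LebesgueConstruction.
Context (R : realType).
Local Notation RT := (measurableTypeR R).

Section Cons.
Context (d : nat) (m : {sigma_finite_measure set (d.-tuple RT) -> \bar R}).

Definition tcons (p : RT * d.-tuple RT) : d.+1.-tuple RT :=
  [the d.+1.-tuple RT of p.1 :: p.2].

Lemma measurable_tcons : measurable_fun [set: RT * d.-tuple RT] tcons.
Proof. exact: measurable_cons. Qed.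

Definition lebesgue_cons : set (d.+1.-tuple RT) -> \bar R :=
  pushforward (lebesgue_measure \x m)%E tcons.

Let lebesgue_cons0 : lebesgue_cons set0 = 0%E.
Proof. by rewrite /lebesgue_cons /pushforward preimage_set0 measure0. Qed.

Let lebesgue_cons_ge0 A : (0 <= lebesgue_cons A)%E.
Proof. by rewrite /lebesgue_cons /pushforward; exact: measure_ge0. Qed.

Let lebesgue_cons_sigma_additive : semi_sigma_additive lebesgue_cons.
Proof.
move=> F mF tF mUF; rewrite /lebesgue_cons /pushforward preimage_bigcup.
apply: measure_semi_sigma_additive.
- by move=> n; rewrite -[X in measurable X]setTI; exact: measurable_tcons.
- apply/trivIsetP => /= i j _ _ ij; rewrite -preimage_setI.
  by move/trivIsetP : tF => /(_ _ _ _ _ ij) ->//; rewrite preimage_set0.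
- by rewrite -preimage_bigcup -[X in measurable X]setTI; exact: measurable_tcons.
Qed.

HB.instance Definition _ := isMeasure.Build _ _ _ lebesgue_cons
  lebesgue_cons0 lebesgue_cons_ge0 lebesgue_cons_sigma_additive.

Let lebesgue_cons_sigma_finite : sigma_finite setT lebesgue_cons.
Proof.
have /sigma_finiteP[F [TF ndF Foo]] := sigma_finiteT (@lebesgue_measure R).
have /sigma_finiteP[G [TG ndG Goo]] := sigma_finiteT m.
have mu : measurable_fun [set: d.+1.-tuple RT]
    (fun t => (thead t, [tuple of behead t]) : RT * d.-tuple RT).
  by apply: measurable_fun_pair; [exact: measurable_tnth|exact: measurable_behead].
exists (fun n => (fun t => (thead t, [tuple of behead t])) @^-1`
                  (F n `*` G n)).
  apply/esym; rewrite -subTset => t _.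
  have [i _ Fi] : (\bigcup_i F i) (thead t) by rewrite -TF.
  have [j _ Gj] : (\bigcup_j G j) [tuple of behead t] by rewrite -TG.
  exists (maxn i j) => //; split => /=.
  - by move: Fi; exact/subsetPset/ndF/leq_maxl.
  - by move: Gj; exact/subsetPset/ndG/leq_maxr.
move=> k; have [mF Fk] := Foo k; have [mG Gk] := Goo k; split.
  by rewrite -[X in measurable X]setTI; apply: mu => //; exact: measurableX.
rewrite /lebesgue_cons /pushforward -comp_preimage.
rewrite (_ : _ \o _ = id) ?preimage_id; last first.
  by apply/funext => -[x t] /=; congr (_, _); exact/val_inj.
by rewrite product_measure1E// lte_mul_pinfty// ge0_fin_numE.
Qed.

HB.instance Definition _ := Measure_isSigmaFinite.Build _ _ _ lebesgue_cons
  lebesgue_cons_sigma_finite.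

End Cons.

(* d-fold product of the one-dimensional Lebesgue measure, on the Borel sets;
   for d = 0 it is the unit mass on the one-point space *)
Fixpoint lebesgue_tuple (d : nat) :
    {sigma_finite_measure set (d.-tuple RT) -> \bar R} :=
  match d with
  | 0 => \d_([tuple] : 0.-tuple RT)
  | d'.+1 => lebesgue_cons (lebesgue_tuple d')
  end.

End LebesgueConstruction.

Definition lebesgue_display : measure_display.
Proof. exact: default_measure_display. Qed.

Section LebesgueRd.
Context (R : realType) (d : nat).
Local Notation RT := (measurableTypeR R).

Definition col_of_tuple (t : d.-tuple RT) : 'cV[R]_d := \col_i tnth t i.

Local Notation completed_tuple :=
  (@completed_measure_extension _ _ _ (lebesgue_tuple R d)).

(* Caratheodory's sigma-algebra of the outer measure induced by the d-fold
   product measure: the Lebesgue measurable sets, not only the Borel ones *)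
Definition lebesgue_measurable : set (set 'cV[R]_d) :=
  [set A | ((lebesgue_tuple R d)^*)%mu.-cara.-measurable
             (col_of_tuple @^-1` A)].

Let lebesgue_measurable0 : lebesgue_measurable set0.
Proof. by rewrite /lebesgue_measurable /= preimage_set0; exact: measurable0. Qed.

Let lebesgue_measurableC A :
  lebesgue_measurable A -> lebesgue_measurable (~` A).
Proof.
by rewrite /lebesgue_measurable /= preimage_setC => mA; exact: measurableC.
Qed.

Let lebesgue_measurable_bigcup (F : (set 'cV[R]_d)^nat) :
  (forall i, lebesgue_measurable (F i)) ->
  lebesgue_measurable (\bigcup_i F i).
Proof.
rewrite /lebesgue_measurable /= preimage_bigcup => mF.
by apply: bigcupT_measurable => i; exact: mF.
Qed.

HB.instance Definition _ := @isMeasurable.Build lebesgue_display 'cV[R]_d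
  lebesgue_measurable lebesgue_measurable0 lebesgue_measurableC
  lebesgue_measurable_bigcup.

Definition lebesgue (A : set 'cV[R]_d) : \bar R :=
  completed_tuple (col_of_tuple @^-1` A).

Let lebesgue0 : lebesgue set0 = 0%E.
Proof. by rewrite /lebesgue preimage_set0 measure0. Qed.

Let lebesgue_ge0 A : (0 <= lebesgue A)%E.
Proof. exact: measure_ge0. Qed.

Let lebesgue_sigma_additive : semi_sigma_additive lebesgue.
Proof.
move=> F mF tF mUF; rewrite /lebesgue preimage_bigcup.
apply: measure_semi_sigma_additive.
- by move=> i; exact: mF.
- apply/trivIsetP => /= i j _ _ ij; rewrite -preimage_setI.
  by move/trivIsetP : tF => /(_ _ _ _ _ ij) ->//; rewrite preimage_set0.
- by rewrite -preimage_bigcup; exact: mUF.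
Qed.

HB.instance Definition _ := isMeasure.Build _ _ _ lebesgue
  lebesgue0 lebesgue_ge0 lebesgue_sigma_additive.

End LebesgueRd.

Section L2.
Context d (T : measurableType d) (R : realType)
  (mu : {measure set T -> \bar R}).
Implicit Types f g : T -> R[i].

Definition complex_measurable f :=
  measurable_fun setT (fun x => complex.Re (f x)) /\
  measurable_fun setT (fun x => complex.Im (f x)).

Definition L2norm f : \bar R :=
  ('N[mu]_2%:E[(fun x => (Normc.normc (f x))%:E)])%E.

Definition in_L2 f := complex_measurable f /\ (L2norm f < +oo)%E.

Definition L2inner f g : R[i] :=
  Complex (\int[mu]_x complex.Re (f x * (g x)^*))
          (\int[mu]_x complex.Im (f x * (g x)^*)).

(* orthonormal basis of the Hilbert space L^2(mu): an orthonormal family whose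
   finite linear combinations are dense *)
Definition L2_orthonormal_basis (I : eqType) (S : set I) (e : I -> T -> R[i]) :=
  [/\ forall i, S i -> in_L2 (e i),
      forall i j, S i -> S j -> L2inner (e i) (e j) = (i == j)%:R
    & forall f, in_L2 f -> forall eps : R, 0 < eps ->
      exists (s : seq I) (c : I -> R[i]),
        (forall i, i \in s -> S i) /\
        (L2norm (fun x => (f x - \sum_(i <- s) c i * e i x)%R) < eps%:E)%E].

End L2.

Section Gabor.
Context (R : realType).

Definition lattice n (M : 'M[R]_n) : set 'cV[R]_n :=
  range (fun z : 'cV[int]_n => M *m map_mx intr z).

Definition dotv d (x y : 'cV[R]_d) : R := \sum_i x i 0 * y i 0.

Definition cis (t : R) : R[i] := Complex (cos t) (sin t).

(* pi(a, b) for the point l = (a, b), stored as the column a above b *)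
Definition time_freq_shift d (l : 'cV[R]_(d + d)) (g : 'cV[R]_d -> R[i]) :
    'cV[R]_d -> R[i] :=
  fun x => cis (2 * pi * dotv (dsubmx l) x) * g (x - usubmx l).

Definition gabor_orthonormal_basis d (g : 'cV[R]_d -> R[i])
    (L : set 'cV[R]_(d + d)) :=
  L2_orthonormal_basis (@lebesgue R d) L (fun l => time_freq_shift l g).

Definition normalized_indicator d (K : set 'cV[R]_d) : 'cV[R]_d -> R[i] :=
  fun x => (fine (lebesgue K) `^ (- 2^-1) * \1_K x)%:C.

End Gabor.

Section Tiling.
Context (R : realType) (d : nat).
Implicit Types (K D G J : set 'cV[R]_d).

(* lebesgue is an outer measure on arbitrary sets, so this needs no
   measurability assumption to mean that the symmetric difference is null *)
Definition ae_eq_set K D := lebesgue (K `+` D) = 0%E.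

(* D meets each coset x + G in exactly one point *)
Definition fundamental_domain G D :=
  measurable D /\ forall x, exists! y, D y /\ G (y - x).

Definition ae_fundamental_domain G D :=
  measurable D /\ exists D0, fundamental_domain G D0 /\ ae_eq_set D D0.

Definition multi_tiles K J (N : nat) :=
  {ae (@lebesgue R d), forall x,
    (\esum_(t in J) (\1_K (x + t)%R : R)%:E = (N%:R : R)%:E)%E}.

End Tiling.

(* Main.v *)
(** Write Gamma = B^-t Z^d, e_n(x) = exp(2 i pi <B n, x>) and let P be the unit
    cell of Gamma. The part m = 0 of the Gabor system says that all e_n with
    n <> 0 have integral 0 over K, as they do over P. An integrable function
    orthogonal to every e_n is orthogonal to every bounded measurable
    Gamma-periodic function, so the Gamma-periodization of chi_K is the constant
    N = |K| / |P|, necessarily a positive integer.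

    For S contained in a translate of P, the projection of f = chi_S onto the
    closed span of the block m of the basis is, up to a unimodular factor, 1/N
    times chi_(K + A m) times the periodization of chi_(S /\ (K + A m)):
    orthogonality of distinct blocks extends from the e_n to all periodic
    multipliers. Its squared norm is |S /\ (K + A m)| / N, and Parseval gives
    N |S| = sum_m |S /\ (K + A m)|; hence K also tiles by A Z^d at level N.

    A set tiling by a lattice at level N is cut into N fundamental domains by
    enumerating the points of each coset. *)
From HB Require Import structures.
Require Import Defs.
From mathcomp Require Import all_boot all_order all_algebra complex.
From mathcomp Require Import all_classical all_reals all_analysis.
From mathcomp Require Import measurable_realfun lra.
Import Order.TTheory GRing.Theory Num.Theory.
Import numFieldNormedType.Exports.

Local Open Scope classical_set_scope.
Local Open Scope ring_scope.

Set Implicit Arguments.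
Unset Strict Implicit.
Unset Printing Implicit Defensive.

(** * Lebesgue measure on R^d *)

(** The passage from exponentials to bounded periodic multipliers is measure-theoretic. For an
    integrable weight [w] orthogonal to all exponentials, consider the bounded phi such that [w] phi
    is still orthogonal to all of them. This class is closed under linear combinations, products
    with trigonometric functions and, by dominated convergence, bounded pointwise limits. The sets
    whose indicators multiply the class into itself form a sigma-algebra. It contains the null sets
    and, through polynomials in one cosine that converge to the indicator of an arc, the coordinate
    arcs of the torus; hence it contains every periodic Lebesgue set.

    The obstacle for the second tiling is that block m carries the factor exp(2 i pi <C m, x>),
    which is not Gamma-periodic, and that A Z^d is a priori unrelated to Gamma. Comparing x with its
    representative in the cell that contains S splits off this factor and leaves a periodic one. The
    projection of chi_S onto block m then has the coefficients of chi_S in that block and none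
    elsewhere, so Parseval applied to the projection gives the exact energy of one block. *)

Section OuterMeasure.
Context d (T : measurableType d) (R : realType).

(** Intersect measurable covers whose measures approach the outer measure. *)
Lemma mu_ext_hull (mu : {measure set T -> \bar R}) (E : set T) :
  ((mu^*)%mu E < +oo)%E ->
  exists2 F, measurable F & E `<=` F /\ (mu^*)%mu E = mu F.
Proof.
move=> Eoo; have Efin : (mu^*)%mu E \is a fin_num.
  by rewrite ge0_fin_numE// mu_ext_ge0.
have cover n : exists F, [/\ measurable F, E `<=` F &
    (mu F < (mu^*)%mu E + n.+1%:R^-1%:E)%E].
  have n0 : (0 < n.+1%:R^-1 :> R)%R by rewrite invr_gt0.
  have [_ [/= A [mA EA] <-] lt] := lb_ereal_inf_adherent n0 Efin.
  exists (\bigcup_k A k); split => //; first exact: bigcupT_measurable.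
  apply: le_lt_trans lt; apply: measure_sigma_subadditive => //.
  exact: bigcupT_measurable.
have [F FP] := choice cover.
have mF : measurable (\bigcap_n F n).
  by apply: bigcapT_measurable => n; have [] := FP n.
have EF : E `<=` \bigcap_n F n by apply: sub_bigcap => n _; have [] := FP n.
exists (\bigcap_n F n) => //; split => //.
apply/eqP; rewrite eq_le; apply/andP; split.
  by rewrite -(measurable_mu_extE mu mF); exact: le_mu_ext.
apply/lee_addgt0Pr => _/posnumP[e]; near \oo => n.
apply: (@le_trans _ _ (mu (F n))).
  apply: le_measure; rewrite ?inE//; first by have [] := FP n.
  exact: bigcap_inf.
have [_ _ /ltW/le_trans ->//] := FP n.
apply: leeD => //; rewrite lee_fin ltW//.
by near: n; exact: near_infty_natSinv_lt.
Unshelve. all: by end_near. Qed.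

(** The hull is taken on each piece [E] /\ [U n], where finiteness allows measures to be subtracted
    and the excess becomes null. The countably many null excesses are then glued. *)
Lemma cara_measurable_hull (mu : {measure set T -> \bar R}) (E : set T) :
  sigma_finite setT mu -> ((mu^*)%mu).-cara.-measurable E ->
  exists2 F, measurable F & E `<=` F /\ (mu^*)%mu (F `\` E) = 0%E.
Proof.
move=> [U TU mU] mE.
have mUc n : ((mu^*)%mu).-cara.-measurable (U n).
  by apply: caratheodory_measurable_mu_ext; have [] := mU n.
have hull n : exists F, [/\ measurable F, E `&` U n `<=` F &
    (mu^*)%mu (F `\` (E `&` U n)) = 0%E].
  have EUoo : ((mu^*)%mu (E `&` U n) < +oo)%E.
    apply: le_lt_trans (mU n).2; rewrite -(measurable_mu_extE mu); last exact: (mU n).1.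
    by apply: le_mu_ext; exact: subIsetr.
  have [F mF [EF muF]] := mu_ext_hull EUoo.
  exists F; split => //.
  have mFc := caratheodory_measurable_mu_ext mu mF.
  have mEU := measurableI _ _ mE (mUc n).
  have Foo : ((mu^*)%mu F < +oo)%E by rewrite measurable_mu_extE// -muF.
  have muD : (mu^*)%mu (F `\` (E `&` U n)) =
      ((mu^*)%mu F - (mu^*)%mu (F `&` (E `&` U n)))%E.
    exact: (@measureD _ _ _ (@completed_measure_extension _ _ _ mu)).
  apply: (etrans muD); rewrite setIidr// muF measurable_mu_extE// subee//.
  by rewrite ge0_fin_numE// -muF.
have [F FP] := choice hull.
exists (\bigcup_n F n).
  by apply: bigcupT_measurable => n; have [] := FP n.
split=> [x Ex|].
  have : setT x by [].
  by rewrite TU => -[n _ Ux]; exists n => //; have [_ + _] := FP n; apply.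
apply/eqP; rewrite eq_le mu_ext_ge0 ?andbT//.
apply: (@le_trans _ _ ((mu^*)%mu (\bigcup_n (F n `\` (E `&` U n))))).
  apply: le_mu_ext => x [[n _ Fx] nEx]; exists n => //; split => //.
  by move=> [].
apply: (le_trans (outer_measure_sigma_subadditive ((mu^*)%mu) _)).
by rewrite eseries0// => n _ _; have [] := FP n.
Qed.

(** A cover of [E] pulls back to a cover of the preimage with the same total measure. For a
    translation, the inverse translation gives the reverse inequality. *)
Lemma mu_ext_preimage (mu : {measure set T -> \bar R}) (f : T -> T)
    (E : set T) :
  measurable_fun setT f ->
  (forall A, measurable A -> mu (f @^-1` A) = mu A) ->
  ((mu^*)%mu (f @^-1` E) <= (mu^*)%mu E)%E.
Proof.
move=> mf muf; apply: le_ereal_inf_tmp => _ [A [mA EA] <-].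
apply: ereal_inf_lbound; exists (fun k => f @^-1` A k).
  split=> [k|x /EA[k _ Akx]]; last by exists k.
  by rewrite -[X in measurable X]setTI; exact: mf.
by apply: eq_eseriesr => k _; exact: muf.
Qed.

End OuterMeasure.

(** * Translation invariance and boxes for the product measure on tuples *)

Section TupleMeasure.
Context (R : realType).
Local Notation RT := (measurableTypeR R).

Lemma lebesgue_measure_shift (s : R) (A : set RT) : measurable A ->
  lebesgue_measure ((fun x => x + s) @^-1` A) = lebesgue_measure A.
Proof.
move=> mA.
have ms : measurable_fun setT (fun x : RT => x + s : RT).
  by apply: measurable_funD => //; exact: measurable_cst.
pose shift_mfun : {mfun RT >-> RT} :=
  HB.pack (fun x : RT => x + s : RT) (isMeasurableFun.Build _ _ _ _ _ ms).
apply/esym.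
apply: (@lebesgue_measure_unique R (pushforward lebesgue_measure shift_mfun)) => //.
move=> _ [[a b] _ <-] /=.
rewrite /pushforward /=.
rewrite (_ : _ @^-1` _ = `](a - s), (b - s)]%classic); last first.
  by apply/seteqP; split => x /=; rewrite !in_itv/= ltrBlDr lerBrDr.
rewrite !lebesgue_measure_itv/= !lte_fin ltrD2r.
by case: ifP => // _; rewrite -!EFinD opprB addrA subrK.
Qed.

Definition shift_tuple n (s t : n.-tuple RT) : n.-tuple RT :=
  [tuple tnth t i + tnth s i | i < n].

Lemma measurable_shift_tuple n (s : n.-tuple RT) :
  measurable_fun setT (shift_tuple s).
Proof.
apply/measurable_fun_tnthP => i.
rewrite (_ : _ \o _ = fun t => tnth t i + tnth s i); last first.
  by apply/funext => t /=; rewrite tnth_mktuple.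
by apply: measurable_funD; [exact: measurable_tnth|exact: measurable_cst].
Qed.

(** Induction on the dimension: the hypothesis translates the sections, and invariance of the
    one-dimensional measure treats the integral over the first coordinate. *)
Lemma lebesgue_tuple_shift n (s : n.-tuple RT) (A : set (n.-tuple RT)) :
  measurable A ->
  lebesgue_tuple R n (shift_tuple s @^-1` A) = lebesgue_tuple R n A.
Proof.
elim: n s A => [|n IH] s A mA.
  rewrite (_ : _ @^-1` A = A)//.
  by apply/funext => t; rewrite /preimage/= [shift_tuple s t]tuple0 [t]tuple0.
rewrite /= /lebesgue_cons /pushforward /=.
rewrite /product_measure1.
pose s0 := thead s; pose s' := [tuple of behead s].
have mcA : measurable (@tcons R n @^-1` A).
  by rewrite -[X in measurable X]setTI; exact: measurable_tcons.
transitivity (\int[lebesgue_measure]_x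
   (lebesgue_tuple R n \o xsection (@tcons R n @^-1` A)) (x + s0)%R)%E.
  apply: eq_integral => x _ /=.
  rewrite -[RHS](IH s'); last exact: measurable_xsection.
  congr (lebesgue_tuple R n _); apply/funext => t.
  rewrite /xsection /preimage /= !inE /=.
  rewrite (_ : shift_tuple s _ = tcons (x + s0, shift_tuple s' t)) //.
  apply: eq_from_tnth => i; rewrite tnth_mktuple /tcons /=.
  case: (unliftP ord0 i) => [j ->|->]; last by rewrite !tnth0.
  rewrite !tnthS tnth_mktuple /s' tnth_behead; congr (_ + tnth _ _).
  by apply/val_inj => /=; rewrite inordK// ltnS.
have ms : measurable_fun setT (fun x : RT => x + s0 : RT).
  by apply: measurable_funD => //; exact: measurable_cst.
have mf : measurable_fun setT (lebesgue_tuple R n \o xsection (@tcons R n @^-1` A)).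
  exact: measurable_fun_xsection.
have f0 : {in [set: RT], forall x,
    (0 <= (lebesgue_tuple R n \o xsection (@tcons R n @^-1` A)) x)%E} by [].
have := ge0_integral_pushforward ms lebesgue_measure measurableT mf f0.
rewrite preimage_setT => <-.
apply: eq_measure_integral => /= B mB _; exact: lebesgue_measure_shift.
Qed.

Lemma measurable_box n (a : R) :
  measurable [set t : n.-tuple RT | forall i, `|tnth t i| <= a].
Proof.
rewrite (_ : [set _ | _] =
    \bigcap_(i in [set: 'I_n]) ((@tnth n RT)^~ i @^-1` [set x | `|x| <= a])).
  apply: fin_bigcap_measurable => // i _.
  rewrite -[X in measurable X]setTI; apply: measurable_tnth => //.
  rewrite (_ : [set _ | _] = `[- a, a]%classic) //.
  by apply/seteqP; split => x /=; rewrite in_itv/= ler_norml.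
by apply/seteqP; split => [t ta i _|t ta i] /=; [exact: ta|exact: (ta i)].
Qed.

Lemma lebesgue_tuple_box n (a : R) :
  (lebesgue_tuple R n [set t | forall i, `|tnth t i| <= a]%R < +oo)%E.
Proof.
elim: n => [|n IH].
  by rewrite /= diracE; case: (_ \in _); rewrite ltry.
rewrite /= /lebesgue_cons /pushforward.
rewrite (_ : _ @^-1` _ = `[- a, a]%classic `*` [set t | forall i, `|tnth t i| <= a]).
  rewrite product_measure1E//; last exact: measurable_box.
  rewrite [X in (X * _)%E](lebesgue_measure_itv `[(- a), a])/=.
  case: ifP => [|_]; last by rewrite mul0e ltry.
  rewrite lte_fin => /ltW aa; rewrite -EFinD lte_mul_pinfty//.
  by rewrite lee_fin subr_ge0.
apply/seteqP; split => -[x t] /=.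
  move=> ta; split.
    by rewrite in_itv/= -ler_norml; have := ta ord0; rewrite /tcons tnth0.
  by move=> i; have := ta (lift ord0 i); rewrite /tcons tnthS.
rewrite in_itv/= -ler_norml => -[xa ta] i.
by case: (unliftP ord0 i) => [j ->|->]; rewrite /tcons ?tnthS ?tnth0.
Qed.

End TupleMeasure.

(** * Transfer to Lebesgue measure on column vectors *)

Section LebesgueMeasure.
Context (R : realType) (d : nat).
Local Notation RT := (measurableTypeR R).
Local Notation X := 'cV[R]_d.
Local Notation leb := (@lebesgue R d).

Let coords (x : X) : d.-tuple RT := [tuple x i 0 | i < d].

Let coordsK : cancel coords (@col_of_tuple R d).
Proof. by move=> x; apply/colP => i; rewrite mxE tnth_mktuple. Qed.

Let col_of_tupleK : cancel (@col_of_tuple R d) coords.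
Proof. by move=> t; apply: eq_from_tnth => i; rewrite tnth_mktuple mxE. Qed.

Lemma lebesgueE (A : set X) :
  lebesgue A = ((lebesgue_tuple R d)^*)%mu (@col_of_tuple R d @^-1` A).
Proof. by []. Qed.

Lemma lebesgue_null_measurable (N : set X) : lebesgue N = 0%E -> measurable N.
Proof.
move=> N0.
apply: (@measure_is_complete_caratheodory _ _ ((lebesgue_tuple R d)^*)%mu).
have [F mF [NF muF]] : exists2 F, measurable F &
    @col_of_tuple R d @^-1` N `<=` F /\
    ((lebesgue_tuple R d)^*)%mu (@col_of_tuple R d @^-1` N) =
    lebesgue_tuple R d F.
  by apply: mu_ext_hull; rewrite -lebesgueE N0.
exists F; split => //; first exact: caratheodory_measurable_mu_ext.
exact: etrans (measurable_mu_extE _ mF) (etrans (esym muF) N0).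
Qed.

Lemma lebesgue_le (A B : set X) : A `<=` B -> (lebesgue A <= lebesgue B)%E.
Proof. by move=> AB; rewrite !lebesgueE; apply: le_mu_ext => t /AB. Qed.

Lemma lebesgue_null_sub (A B : set X) :
  A `<=` B -> lebesgue B = 0%E -> lebesgue A = 0%E.
Proof.
move=> AB B0; apply/eqP; rewrite eq_le measure_ge0 andbT -B0.
exact: lebesgue_le.
Qed.

Let shift_col (s x : X) : X := x + s.

Let shift_col_tuple s (A : set X) :
  @col_of_tuple R d @^-1` (shift_col s @^-1` A) =
  shift_tuple (coords s) @^-1` (@col_of_tuple R d @^-1` A).
Proof.
apply/funext => t; rewrite /preimage /=; congr (A _).
by apply/colP => i; rewrite !mxE !tnth_mktuple.
Qed.

Lemma lebesgue_shift (s : X) (A : set X) :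
  lebesgue ((fun x => x + s) @^-1` A) = lebesgue A.
Proof.
have le s' B : (lebesgue (shift_col s' @^-1` B) <= lebesgue B)%E.
  rewrite !lebesgueE shift_col_tuple; apply: mu_ext_preimage.
    exact: measurable_shift_tuple.
  by move=> C mC; exact: lebesgue_tuple_shift.
apply/eqP; rewrite eq_le le /=.
apply: le_trans (le (- s) _); rewrite le_eqVlt; apply/orP; left; apply/eqP.
by congr (lebesgue _); apply/funext => x; rewrite /preimage/= /shift_col subrK.
Qed.

(** Caratheodory's criterion with test sets of columns: [lebesgue] is defined on all sets, so a test
    set may be transformed freely. *)
Lemma lebesgue_measurableP (A : set X) : measurable A <->
  forall Z : set X, lebesgue Z = (lebesgue (Z `&` A) + lebesgue (Z `&` ~` A))%E.
Proof.
split=> [mA Z|AZ]; first exact: mA.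
suff mY : lebesgue_measurable A by exact: mY.
move=> Y.
have YE : Y = @col_of_tuple R d @^-1` (coords @^-1` Y).
  by apply/funext => t; rewrite /preimage/= col_of_tupleK.
by rewrite YE; exact: AZ.
Qed.

Lemma measurable_shift (s : X) : measurable_fun setT (fun x : X => x + s).
Proof.
move=> _ A mA; rewrite setTI; apply/lebesgue_measurableP => Z.
(* The translation is moved from the measurable set onto the test set, which is arbitrary in the
   criterion. *)
have shiftE B : lebesgue (Z `&` (fun x : X => x + s) @^-1` B) =
    lebesgue ((fun x : X => x + - s) @^-1` Z `&` B).
  rewrite -(lebesgue_shift s (_ `&` B)); congr (lebesgue _).
  by apply/seteqP; split => x; rewrite /= addrK.
rewrite preimage_setC !shiftE -(lebesgue_shift (- s) Z).
by move/lebesgue_measurableP : mA; apply.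
Qed.

Lemma measurable_coord i : measurable_fun setT (fun x : X => x i 0 : RT).
Proof.
move=> _ B mB; rewrite setTI.
apply: caratheodory_measurable_mu_ext.
rewrite -comp_preimage.
rewrite (_ : _ \o _ = (@tnth d RT)^~ i); last first.
  by apply/funext => t /=; rewrite mxE.
by rewrite -[X in measurable X]setTI; exact: measurable_tnth.
Qed.

(* Lebesgue sets are Borel sets up to a null set, so a sigma-algebra containing
   the null sets and the cylinders over Borel sets contains all of them *)
Lemma lebesgue_measurable_ind (S : set (set X)) :
  sigma_algebra setT S ->
  (forall i (B : set RT), measurable B -> S ((fun x : X => x i 0) @^-1` B)) ->
  (forall N, lebesgue N = 0%E -> S N) ->
  measurable `<=` S.
Proof.
move=> [S0 SC SU] Scyl Snull A mA.
have [F mF [AF FA0]] : exists2 F, measurable F &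
    @col_of_tuple R d @^-1` A `<=` F /\
    ((lebesgue_tuple R d)^*)%mu (F `\` @col_of_tuple R d @^-1` A) = 0%E.
  by apply: cara_measurable_hull => //; exact: sigma_finiteT.
have SF : S (coords @^-1` F).
  move: F mF {AF FA0}; apply: smallest_sub.
    split; first by rewrite /= preimage_set0.
      move=> B /= SB; rewrite setTD preimage_setC -setTD; exact: SC.
    by move=> B SB; rewrite /= preimage_bigcup; exact: SU.
  move=> F; rewrite -bigcup_seq /= => -[i _ [B mB <-]] /=; rewrite setTI.
  rewrite -comp_preimage (_ : _ \o _ = fun x : X => x i 0); first exact: Scyl.
  by apply/funext => x /=; rewrite tnth_mktuple.
have SD B C : S B -> S C -> S (B `\` C).
  move=> SB SC'; rewrite setDE -[B]setCK -setCU -[~` (_ `|` _)]setTD.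
  apply: (SC); rewrite -bigcup2E; apply: SU => -[|[|n]] //=.
  - by rewrite -setTD; exact: SC.

(* [A] is its Borel hull with the null excess removed. *)
rewrite (_ : A = (coords @^-1` F) `\` ((coords @^-1` F) `\` A)).
  apply: SD => //; apply: Snull; rewrite lebesgueE -[RHS]FA0; congr (_^*%mu _).
  by apply/funext => t; rewrite /preimage /= /setD /= col_of_tupleK.
rewrite setDD setIidr// => x Ax; apply: AF; rewrite /preimage /=.
by rewrite coordsK.
Qed.

Lemma lebesgue_box (a : R) :
  (lebesgue [set x : X | forall i, `|x i 0| <= a]%R < +oo)%E.
Proof.
rewrite lebesgueE (_ : _ @^-1` _ = [set t | forall i, `|tnth t i| <= a]).
  by rewrite measurable_mu_extE; [exact: lebesgue_tuple_box|exact: measurable_box].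
by apply/seteqP; split => t ta i; have := ta i; rewrite mxE.
Qed.

End LebesgueMeasure.

(** * Lattices, periodization and multi-tiling *)

Lemma esum_single (R : realType) (I : choiceType) (f : I -> \bar R) i0 :
  (0 <= f i0)%E -> (forall i, i != i0 -> f i = 0%E) ->
  \esum_(i in [set: I]) f i = f i0.
Proof.
move=> f0 fi; rewrite -(esum_set1 f0) [RHS]esum_mkcond; apply: eq_esum => i _.
by case: ifPn => //; rewrite notin_setE /= => /eqP; exact: fi.
Qed.

Section CountableSums.
Context d (T : measurableType d) (R : realType) (I : countType).
Local Open Scope ereal_scope.
Implicit Types f : I -> \bar R.

(** Carries sums over a countable type to series, where the theorems on measurability and
    integration of series apply; integers that code no index contribute 0. *)
Lemma esum_countType f : (forall i, 0 <= f i) ->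
  \esum_(i in [set: I]) f i = \sum_(k <oo) oapp f 0 (pickle_inv k).
Proof.
move=> f0; rewrite nneseries_esumT; last first.
  by move=> k; case: (pickle_inv k) => //=.
rewrite [RHS](_ : _ = \esum_(k in range (@pickle I)) oapp f 0 (pickle_inv k)).
  rewrite (@reindex_esum R I nat [set: I] (range (@pickle I)) (@pickle I)).
    by apply: eq_esum => i _; rewrite pickleK_inv.
  split; [by move=> i _; exists i| |by move=> k [i _ <-]; exists i].
  by move=> i j _ _; exact: (pcan_inj pickleK).
rewrite [RHS]esum_mkcond; apply: eq_esum => k _.
case: ifPn => //; rewrite notin_setE => nk.
have := @pickle_invK I k; case: (pickle_inv k) => //= i ik.
by exfalso; apply: nk; exists i.
Qed.

Lemma measurable_esum (D : set T) (f : I -> T -> \bar R) :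
  (forall i x, 0 <= f i x) -> (forall i, measurable_fun D (f i)) ->
  measurable_fun D (fun x => \esum_(i in [set: I]) f i x).
Proof.
move=> f0 mf.
rewrite (_ : (fun x => _) = fun x => \sum_(k <oo | k \in predT)
    oapp (f^~ x) 0 (pickle_inv k)); last first.
  by apply/funext => x; rewrite esum_countType.
by apply: ge0_emeasurable_sum => [k x _ _|k _]; case: (pickle_inv k) => /=.
Qed.

Lemma integral_esum (mu : {measure set T -> \bar R}) (D : set T)
    (f : I -> T -> \bar R) : measurable D ->
  (forall i x, 0 <= f i x) -> (forall i, measurable_fun D (f i)) ->
  \int[mu]_(x in D) (\esum_(i in [set: I]) f i x) =
  \esum_(i in [set: I]) (\int[mu]_(x in D) f i x).
Proof.
move=> mD f0 mf; rewrite esum_countType; last by move=> i; exact: integral_ge0.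
under eq_integral do rewrite esum_countType//.
rewrite integral_nneseries//.
- by apply: eq_eseriesr => k _; case: (pickle_inv k) => //=; rewrite integral0.
- by move=> k; case: (pickle_inv k) => /=.
- by move=> k x _; case: (pickle_inv k) => /=.
Qed.

End CountableSums.

Section IntegralShift.
Context (R : realType) (d : nat).
Local Notation X := 'cV[R]_d.
Local Notation leb := (@lebesgue R d).

Lemma negligible_lebesgueP (N : set X) : leb.-negligible N <-> lebesgue N = 0%E.
Proof.
split=> [[A [mA A0 NA]]|N0]; first exact: lebesgue_null_sub NA A0.
by exists N; split => //; exact: lebesgue_null_measurable.
Qed.

Lemma lebesgue_null_bigcup (I : countType) (F : I -> set X) :
  (forall i, lebesgue (F i) = 0%E) -> lebesgue (\bigcup_i F i) = 0%E.
Proof.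
move=> F0; apply/negligible_lebesgueP.
rewrite (_ : \bigcup_i F i = \bigcup_k oapp F set0 (pickle_inv k)).
  apply: negligible_bigcup => k; case: (pickle_inv k) => [i|] /=.
    exact/negligible_lebesgueP.
  exact: negligible_set0.
apply/seteqP; split => [x [i _ Fi]|x [k _]].
  by exists (pickle i) => //; rewrite pickleK_inv.
by case: (pickle_inv k) => //= i Fi; exists i.
Qed.

Lemma ge0_integral_shift (s : X) (f : X -> \bar R) :
  measurable_fun setT f -> (forall x, (0 <= f x)%E) ->
  (\int[leb]_x f (x + s)%R = \int[leb]_x f x)%E.
Proof.
move=> mf f0.
have f0' : {in [set: X], forall x, (0 <= f x)%E} by move=> x _; exact: f0.
have ms := @measurable_shift R d s.
pose shift_mfun : {mfun X >-> X} :=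
  HB.pack (fun x : X => x + s) (isMeasurableFun.Build _ _ _ _ _ ms).
have := ge0_integral_pushforward ms leb measurableT mf f0'.
rewrite preimage_setT => <-.
rewrite (@eq_measure_integral _ _ _ _ leb (pushforward leb shift_mfun))//.
by move=> A _ _; exact: lebesgue_shift.
Qed.

End IntegralShift.

(** * Cells, representatives and unfolding for the lattice of an invertible matrix *)

Section Lattice.
Context (R : realType) (d : nat) (T : 'M[R]_d).
Hypothesis uT : T \in unitmx.
Local Notation X := 'cV[R]_d.
Local Notation Z := 'cV[int]_d.
Local Notation leb := (@lebesgue R d).

Definition lattice_pt (z : Z) : X := T *m map_mx intr z.
Definition lattice_coord (x : X) (i : 'I_d) : R := (invmx T *m x) i 0.
Definition lattice_floor (x : X) : Z := \col_i Num.floor (lattice_coord x i).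
Definition lattice_frac (x : X) : X := x - lattice_pt (lattice_floor x).
(** The half-open parallelepiped spanned by the columns of [T]. *)
Definition lattice_cell : set X := [set x | lattice_floor x = 0].

Lemma lattice_pt0 : lattice_pt 0 = 0.
Proof.
by rewrite /lattice_pt (_ : map_mx _ 0 = 0) ?mulmx0//; apply/matrixP => i j; rewrite !mxE.
Qed.

Lemma lattice_ptD z z' : lattice_pt (z + z') = lattice_pt z + lattice_pt z'.
Proof.
by rewrite /lattice_pt -mulmxDr; congr (_ *m _); apply/matrixP => i j; rewrite !mxE intrD.
Qed.

Lemma lattice_ptN z : lattice_pt (- z) = - lattice_pt z.
Proof. by apply/eqP; rewrite -subr_eq0 opprK -lattice_ptD addNr lattice_pt0. Qed.

Lemma lattice_coord_pt x z i :
  lattice_coord (x + lattice_pt z) i = lattice_coord x i + (z i 0)%:~R.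
Proof.
by rewrite /lattice_coord mulmxDr /lattice_pt mulKmx// !mxE.
Qed.

Lemma lattice_floor_pt x z :
  lattice_floor (x + lattice_pt z) = lattice_floor x + z.
Proof.
apply/colP => i; rewrite !mxE lattice_coord_pt; apply/eqP.
rewrite floor_eq addrAC intrD lerD2r intrD ltrD2r.
exact: floor_itv.
Qed.

Lemma lattice_pt_inj : injective lattice_pt.
Proof.
move=> z z' zz'; have := lattice_floor_pt 0 z.
by rewrite zz' lattice_floor_pt => /addrI.
Qed.

Lemma lattice_frac_pt x z : lattice_frac (x + lattice_pt z) = lattice_frac x.
Proof.
rewrite /lattice_frac lattice_floor_pt lattice_ptD opprD addrACA.
by rewrite subrr addr0 ?addrA.
Qed.

Lemma lattice_cell_frac x : lattice_cell (lattice_frac x).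
Proof.
by rewrite /lattice_cell /= /lattice_frac -lattice_ptN lattice_floor_pt subrr.
Qed.

Lemma lattice_frac_cell x : lattice_cell x -> lattice_frac x = x.
Proof. by rewrite /lattice_cell /lattice_frac /= => ->; rewrite lattice_pt0 subr0. Qed.

Lemma lattice_cell_pt x z :
  lattice_cell (x + lattice_pt z) <-> z = - lattice_floor x.
Proof.
rewrite /lattice_cell /= lattice_floor_pt; split => [/eqP|->]; last exact: addrN.
by rewrite addr_eq0 => /eqP ->; rewrite opprK.
Qed.

Lemma measurable_lattice_coord i :
  measurable_fun setT (fun x : X => lattice_coord x i : measurableTypeR R).
Proof.
rewrite (_ : (fun x => _) = fun x : X => \sum_(j < d) invmx T i j * x j 0).
  apply: measurable_sum => j; apply: measurable_funM; first exact: measurable_cst.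
  exact: measurable_coord.
by apply/funext => x; rewrite /lattice_coord mxE.
Qed.

Lemma measurable_lattice_floor (z : Z) : measurable [set x | lattice_floor x = z].
Proof.
rewrite (_ : [set _ | _] = \bigcap_(i in [set: 'I_d])
    (fun x => lattice_coord x i) @^-1` `[(z i 0)%:~R, (z i 0 + 1)%:~R[).
  apply: fin_bigcap_measurable => // i _; rewrite -[X in measurable X]setTI.
  by apply: measurable_lattice_coord => //; exact: measurable_itv.
apply/seteqP; split => x /=.
  by move=> <- i _; rewrite /= in_itv/= mxE floor_itv.
move=> xz; apply/colP => i; rewrite mxE; apply/eqP; rewrite floor_eq.
by have := xz i I; rewrite /= in_itv.
Qed.

Lemma measurable_lattice_cell : measurable lattice_cell.
Proof. exact: measurable_lattice_floor. Qed.

Lemma esum_lattice (f : X -> \bar R) :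
  (\esum_(t in lattice T) f t = \esum_(z in [set: Z]) f (lattice_pt z))%E.
Proof. by rewrite /lattice esum_image// => z z' _ _; exact: lattice_pt_inj. Qed.

Lemma esum_lattice_shift (f : X -> \bar R) x z0 : (forall x, 0 <= f x)%E ->
  (\esum_(z in [set: Z]) f (x + lattice_pt z0 + lattice_pt z)%R =
   \esum_(z in [set: Z]) f (x + lattice_pt z)%R)%E.
Proof.
move=> f0; rewrite [RHS](reindex_esum setT setT (+%R z0))//.
by apply: eq_esum => z _; rewrite lattice_ptD addrA.
Qed.

Lemma esum_lattice_opp (f : X -> \bar R) x :
  (\esum_(z in [set: Z]) f (x - lattice_pt z)%R =
   \esum_(z in [set: Z]) f (x + lattice_pt z)%R)%E.
Proof.
rewrite [RHS](reindex_esum setT setT -%R)//.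
by apply: eq_esum => z _; rewrite lattice_ptN.
Qed.

(** A countable union of translates. It enlarges an exceptional null set to one that is invariant
    under the lattice. *)
Lemma lebesgue_orbit_null (N : set X) : lebesgue N = 0%E ->
  lebesgue [set x | exists z, N (x + lattice_pt z)] = 0%E.
Proof.
move=> N0; rewrite (_ : [set _ | _] = \bigcup_(z in [set: Z])
    ((fun x => x + lattice_pt z) @^-1` N)).
  by apply: lebesgue_null_bigcup => z; rewrite lebesgue_shift.
by apply/seteqP; split => [x [z Nz]|x [z _ Nz]]; exists z.
Qed.

(** Cut [f] into its restrictions to the translated cells and translate each piece back to the
    cell. *)
Lemma integral_unfold (f : X -> \bar R) :
  measurable_fun setT f -> (forall x, (0 <= f x)%E) ->
  (\int[leb]_x f x =
   \int[leb]_(x in lattice_cell) \esum_(z in [set: Z]) f (x + lattice_pt z)%R)%E.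
Proof.
move=> mf f0.
have mfz z : measurable_fun setT (fun x : X => f (x + lattice_pt z)).
  exact: (measurableT_comp mf (measurable_shift _)).
rewrite (integral_esum leb measurable_lattice_cell (fun z x => f0 _)
  (fun z => measurable_funTS (mfz z))).
pose g z (x : X) := ((f \_ [set x | lattice_floor x = z]) x).
have fE x : f x = \esum_(z in [set: Z]) g z x.
  rewrite (esum_single (i0 := lattice_floor x)).
  - by rewrite /g patchE mem_set.
  - by rewrite /g patchE; case: ifP.
  - by move=> z zx; rewrite /g patchE memNset//= => /esym/eqP; exact/negP.
have mg z : measurable_fun setT (g z).
  apply/(measurable_restrictT _ (measurable_lattice_floor z)).
  exact: measurable_funTS.
have g0 z x : (0 <= g z x)%E by rewrite /g patchE; case: ifP.
under eq_integral do rewrite fE.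
rewrite integral_esum//; apply: eq_esum => z _.
rewrite -(ge0_integral_shift (lattice_pt z))// [RHS]integral_mkcond.
apply: eq_integral => x _; rewrite /g !patchE.
congr (if _ then _ else _); apply/idP/idP; rewrite !inE /lattice_cell /= lattice_floor_pt.
  by rewrite -[X in _ = X]add0r => /addIr.
by move=> ->; rewrite add0r.
Qed.

Lemma lattice_cell_coord x i : lattice_cell x -> 0 <= lattice_coord x i < 1.
Proof.
move=> /(congr1 (fun z : Z => z i 0)); rewrite !mxE => /eqP.
by rewrite floor_eq add0r.
Qed.

Lemma lattice_cell_fin : (lebesgue lattice_cell < +oo)%E.
Proof.
(* In the cell the lattice coordinates lie in [0, 1), so each coordinate of [x] is at most a row sum
   of the |T i j|, hence at most the sum over all entries. *)
pose a : R := \sum_i \sum_j `|T i j|.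
apply: le_lt_trans (@lebesgue_box R d a); apply: lebesgue_le => x Px i.
have -> : x = T *m (invmx T *m x) by rewrite mulKVmx.
rewrite mxE /a [leRHS](bigD1 i)//= ler_wpDr ?sumr_ge0// => [k _|].
  by rewrite sumr_ge0.
apply: le_trans (ler_norm_sum _ _ _) _; apply: ler_sum => j _.
rewrite normrM ler_piMr// ger0_norm.
  by have /andP[_ /ltW] := lattice_cell_coord j Px.
by have /andP[] := lattice_cell_coord j Px.
Qed.

(* the translates of a null cell would cover K *)
Lemma lattice_cell_pos (K : set X) :
  (0 < lebesgue K)%E -> (0 < lebesgue lattice_cell)%E.
Proof.
move=> K0; rewrite lt0e measure_ge0 andbT; apply/eqP => /lebesgue_orbit_null P0.
have : (lebesgue K <= 0)%E.
  rewrite -P0; apply: lebesgue_le => x _; exists (- lattice_floor x).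
  exact/lattice_cell_pt.
by rewrite leNgt K0.
Qed.

End Lattice.

(** * Cutting a set of constant level into fundamental domains *)

Section Decomposition.
Context (R : realType) (d : nat) (T : 'M[R]_d).
Hypothesis uT : T \in unitmx.
Local Notation X := 'cV[R]_d.
Local Notation Z := 'cV[int]_d.
Local Notation leb := (@lebesgue R d).
Local Notation pt := (lattice_pt T).

(** The periodization of the indicator of [K]: the number, possibly infinite, of points of the coset
    of [x] that lie in [K]. *)
Definition lattice_count (K : set X) (x : X) : \bar R :=
  \esum_(z in [set: Z]) (\1_K (x + pt z) : R)%:E.

Lemma measurable_lattice_count K : measurable K ->
  measurable_fun setT (lattice_count K).
Proof.
move=> mK; apply: measurable_esum => [z x|z]; first by rewrite lee_fin indicE.
apply/measurable_EFinP.
apply: (measurableT_comp (f := \1_K : X -> R)); first exact: measurable_indic.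
exact: measurable_shift.
Qed.

Lemma lattice_count_pt K x z :
  lattice_count K (x + pt z) = lattice_count K x.
Proof.
apply: (@esum_lattice_shift R d T (fun y => (\1_K y : R)%:E)) => y.
by rewrite lee_fin indicE.
Qed.

Lemma lattice_count_uniq K x z0 : K (x + pt z0) ->
  (forall z, K (x + pt z) -> z = z0) -> lattice_count K x = 1%E.
Proof.
move=> Kz0 uniq; rewrite /lattice_count (esum_single (i0 := z0)).
- by rewrite indicE mem_set.
- by rewrite indicE mem_set.
- move=> z /eqP zz0; rewrite indicE memNset// => /uniq; exact: zz0.
Qed.

Lemma lattice_count_eq0 K x : lattice_count K x = 0%E ->
  forall z, ~ K (x + pt z).
Proof.
move=> K0 z Kz; have : (1 <= lattice_count K x)%E.
  apply: esum_ge; exists [set z]; first by split => //; exact: finite_set1.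
  by rewrite fsbig_set1 indicE mem_set.
by rewrite K0 lee_fin ler10.
Qed.

Lemma lattice_count_neq0 K x : lattice_count K x != 0%E ->
  exists z, K (x + pt z).
Proof.
move=> K0; apply: contrapT => /forallNP nK; move/eqP: K0; apply; apply: esum1 => z _.
by rewrite indicE memNset.
Qed.

Lemma lattice_count_eq1 K x : lattice_count K x = 1%E ->
  exists! z, K (x + pt z).
Proof.
move=> K1; have [z Kz] : exists z, K (x + pt z).
  by apply: lattice_count_neq0; rewrite K1 eqe oner_eq0.
exists z; split => // z' Kz'; apply: contrapT => zz'.
suff : (2%:E <= lattice_count K x)%E by rewrite K1 lee_fin lern1.
apply: esum_ge; exists [set z; z'].
  split => //; exact: finite_set2.
rewrite fsbigU0//=; first by rewrite !fsbig_set1 !indicE !mem_set// lee_fin.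
by move=> y [/= -> /zz'].
Qed.

(* [first_hit K] selects from each coset the point of K with least code; codes
   are read off relative to the representative of the coset in the cell *)
Definition first_hit (K : set X) : set X :=
  [set x | K x /\ forall z : Z, (pickle z < pickle (lattice_floor T x))%N ->
                   ~ K (lattice_frac T x + pt z)].

Lemma first_hit_sub K : first_hit K `<=` K.
Proof. by move=> x []. Qed.

Lemma measurable_first_hit K : measurable K -> measurable (first_hit K).
Proof.
move=> mK.
(* The points with floor [w] that are beaten by the point of their coset with floor [z]: the latter
   lies in [K] and has a smaller code. *)
pose F (w z : Z) : set X := [set x | lattice_floor T x = w] `&`
  (if (pickle z < pickle w)%N then (fun x => x + (pt z - pt w)) @^-1` K else set0).
rewrite (_ : first_hit K = K `\` \bigcup_w \bigcup_z F w z).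
  apply: measurableD => //; apply: countable_bigcupT_measurable => // w.
  apply: countable_bigcupT_measurable => // z.
  apply: measurableI; first exact: measurable_lattice_floor.
  case: ifP => // _; rewrite -[X in measurable X]setTI.
  exact: measurable_shift.
have FE x w z : F w z x <-> [/\ lattice_floor T x = w,
    (pickle z < pickle w)%N & K (lattice_frac T x + pt z)].
  rewrite /F /lattice_frac; split=> [[/= <-]|[<- zw Kx]].
    by case: ifP => //= _; rewrite addrCA addrC => ?; split.
  by split => //=; rewrite zw /= addrCA addrC.
apply/seteqP; split => x [Kx Hx]; split => //.
  by move=> [w _ [z _ /FE[xw zw Kz]]]; apply: (Hx z) => //; rewrite xw.
move=> z zx Kz; apply: Hx; exists (lattice_floor T x) => //; exists z => //.
exact/FE.
Qed.

Lemma lattice_count_first_hit K x :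
  lattice_count K x != 0%E -> lattice_count (first_hit K) x = 1%E.
Proof.
move=> /lattice_count_neq0[z1 Kz1].
(* The floor of [x + pt z] is the quantity compared by [first_hit]; a least code among the points of
   [K] exists, and injectivity of [pickle] makes its bearer unique. *)
pose code z := pickle (lattice_floor T x + z).
have exn : exists n, `[< exists z, K (x + pt z) /\ code z = n >].
  by exists (code z1); apply/asboolP; exists z1.
have [n /asboolP[z0 [Kz0 z0n]] nmin] := ex_minnP exn.
apply: (@lattice_count_uniq _ _ z0).
  split => // z; rewrite lattice_floor_pt// lattice_frac_pt// => zlt Kz.
  have : (n <= pickle z)%N.
    apply: nmin; apply/asboolP; exists (z - lattice_floor T x); split.
      by move: Kz; rewrite lattice_ptD lattice_ptN [pt z - _]addrC addrA.
    by rewrite /code addrC subrK.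
  by rewrite -z0n leqNgt zlt.
move=> z [Kz Hz].
have [lt|lt|/eqP] := ltngtP (code z) (code z0).
- suff : (n <= code z)%N by rewrite -z0n leqNgt lt.
  by apply: nmin; apply/asboolP; exists z.
- exfalso; apply: (Hz (lattice_floor T x + z0)).
    by rewrite lattice_floor_pt.
  by rewrite lattice_frac_pt// /lattice_frac lattice_ptD addrA subrK.
- by rewrite (inj_eq (pcan_inj pickleK)) (inj_eq (addrI _)) => /eqP.
Qed.

Lemma lattice_countD K D x : D `<=` K ->
  lattice_count K x = (lattice_count D x + lattice_count (K `\` D) x)%E.
Proof.
move=> DK; rewrite /lattice_count -esumD; try by move=> z _; rewrite lee_fin indicE.
apply: eq_esum => z _; rewrite -EFinD; congr _%:E.
rewrite !indicE in_setD; case: (boolP (_ \in D)) => [|_] /=.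
  by rewrite inE => /DK ?; rewrite mem_set// addr0.
by rewrite andbT add0r.
Qed.

(** Removing the first hits lowers the level by one almost everywhere, so induction peels off
    disjoint sets of level one. *)
Lemma level_decomposition N (K : set X) : measurable K ->
  {ae leb, forall x, lattice_count K x = (N%:R)%:E} ->
  exists D : nat -> set X, [/\
    forall j, (j < N)%N -> measurable (D j) /\
       {ae leb, forall x, lattice_count (D j) x = 1%E},
    forall j, D j `<=` K,
    forall i j, i != j -> D i `&` D j = set0
    & lebesgue (K `\` \bigcup_(j in [set j | (j < N)%N]) D j) = 0%E].
Proof.
elim: N K => [|N IH] K mK KN.
  exists (fun=> set0); split => //.
  - by move=> _; exact: sub0set.
  - by move=> i j _; rewrite setI0.
  (* At level 0, every point of [K] counts itself, so [K] lies in the null set where the count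
     differs from 0. *)
  apply: lebesgue_null_sub (_ : lebesgue [set x | lattice_count K x <> 0%E] = 0%E).
    by move=> x [Kx _] /lattice_count_eq0 /(_ 0); rewrite lattice_pt0 addr0.
  by apply/negligible_lebesgueP.
pose D := first_hit K; have mD := measurable_first_hit mK.
have DE x : lattice_count K x = (N.+1%:R)%:E -> lattice_count D x = 1%E /\
    lattice_count (K `\` D) x = (N%:R)%:E.
  move=> xN; have D1 : lattice_count D x = 1%E.
    by apply: lattice_count_first_hit; rewrite xN eqe pnatr_eq0.
  split => //; move: (lattice_countD x (@first_hit_sub K)).
  rewrite xN -/D D1 -natr1 EFinD [RHS]addeC.
  by move/(congr1 (fun y => (y - 1)%E)) => /=; rewrite !addeK.
have [||D' [mD' D'K D'I D'0]] := IH (K `\` D).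
- exact: measurableD.
- by apply: filterS KN => x /DE[].
exists (fun j => if j is j'.+1 then D' j' else D); split.
- case=> [_|j jN]; last exact: mD'.
  by split => //; apply: filterS KN => x /DE[].
- by case=> [|j]; [exact: first_hit_sub|move=> x /D'K[]].
- case=> [|i] [|j]//= ij; last exact: D'I.
    by apply/seteqP; split => x // -[Dx /D'K[_]].
  by apply/seteqP; split => x // -[/D'K[_]].
apply: lebesgue_null_sub D'0 => x [Kx Ux]; split.
  by split => // Dx; apply: Ux; exists 0%N.
by move=> [j jN D'x]; apply: Ux; exists j.+1.
Qed.

Lemma level_one_fundamental D : measurable D ->
  {ae leb, forall x, lattice_count D x = 1%E} ->
  ae_fundamental_domain (lattice T) D.
Proof.
move=> mD D1; split => //.
pose bad := [set x | lattice_count D x <> 1%E].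
have bad0 : lebesgue bad = 0%E by exact/negligible_lebesgueP.
(* The bad set is a union of cosets, so it can be repaired coset by coset: there [D] is replaced by
   the cell. *)
exists ((D `\` bad) `|` (lattice_cell T `&` bad)); split; first split.
- apply: measurableU; first apply: measurableD => //.
    exact: lebesgue_null_measurable.
  apply: measurableI; first exact: measurable_lattice_cell.
  exact: lebesgue_null_measurable.
- have badE x z : bad (x + pt z) = bad x by rewrite /bad /= lattice_count_pt.
  move=> x; have [xbad|/contrapT x1] := pselect (bad x).
    exists (x + pt (- lattice_floor T x)); split.
      split; last first.
        by exists (- lattice_floor T x) => //; rewrite addrC addKr.
      by right; split; [exact/lattice_cell_pt|rewrite badE].
    move=> y [Dy [z _ zy]]; have yE : y = x + pt z.
      by rewrite /lattice_pt zy addrC subrK.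
    rewrite yE in Dy *; case: Dy => -[]; first by rewrite badE.
    by move=> /lattice_cell_pt ->.
  have [z [Dz zuniq]] := lattice_count_eq1 x1.
  exists (x + pt z); split.
    split; last by exists z => //; rewrite addrC addKr.
    by left; split => //; rewrite badE => /(_ x1).
  move=> y [Dy [z' _ zy]]; have yE : y = x + pt z'.
    by rewrite /lattice_pt zy addrC subrK.
  rewrite yE in Dy *; case: Dy => -[].
    by move=> /zuniq ->.
  by move=> _; rewrite badE => /(_ x1).
apply: lebesgue_null_sub bad0 => x [[Dx nD]|[[[Dx _]|[_ xb]] nDx]] //.
by apply: contrapT => xb; apply: nD; left.
Qed.

Lemma multi_tiles_countE K N : multi_tiles K (lattice T) N <->
  {ae leb, forall x, lattice_count K x = (N%:R)%:E}.
Proof.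
rewrite /multi_tiles.
by split; apply: filterS => x; rewrite esum_lattice.
Qed.

Lemma multi_tiles_decomposition (K : set X) N : measurable K ->
  multi_tiles K (lattice T) N ->
  exists D : 'I_N -> set X,
      [/\ forall j, ae_fundamental_domain (lattice T) (D j),
          forall i j, i != j -> lebesgue (D i `&` D j) = 0%E
        & ae_eq_set K (\bigcup_j D j)].
Proof.
move=> mK /multi_tiles_countE KN.
have [D [DN DK DI D0]] := level_decomposition mK KN.
exists (fun j : 'I_N => D j); split.
- by move=> j; have [] := DN j (ltn_ord j); exact: level_one_fundamental.
- by move=> i j ij; rewrite DI// measure0.
- apply: lebesgue_null_sub D0 => x [[Kx nU]|[[j _ Dj] /(_ (DK _ _ Dj))//]].
  by split => // -[j jN Dj]; apply: nU; exists (Ordinal jN).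
Qed.

End Decomposition.

(** * Trigonometric functions determine periodic functions *)

Section Threshold.
Context (R : realType).
Implicit Types (t x y a f : R).

Lemma bernoulli_sub y m : 0 <= y <= 1 -> 1 - m%:R * y <= (1 - y) ^+ m.
Proof.
move=> /andP[y0 y1]; elim: m => [|m IH]; first by rewrite mul0r subr0 expr0.
rewrite exprS; apply: (@le_trans _ _ ((1 - y) * (1 - m%:R * y))).
  rewrite -natr1 mulrDl mulrBl !mul1r mulrBr mulr1.
  have : 0 <= y * (m%:R * y) by rewrite !mulr_ge0.
  by move: (m%:R * y) (y * _) => *; lra.
by rewrite ler_wpM2l// subr_ge0.
Qed.

Lemma bernoulli_add y m : 0 <= y -> 1 + m%:R * y <= (1 + y) ^+ m.
Proof.
move=> y0; elim: m => [|m IH]; first by rewrite mul0r addr0 expr0.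
rewrite exprS; apply: (@le_trans _ _ ((1 + y) * (1 + m%:R * y))).
  rewrite -natr1 !mulrDl !mul1r mulrDr mulr1.
  have : 0 <= y * (m%:R * y) by rewrite !mulr_ge0.
  by move: (m%:R * y) (y * _) => *; lra.
by rewrite ler_wpM2l// addr_ge0.
Qed.

(** With s the square root of r, k r^k = (k s^k) s^k, and Bernoulli's inequality for 1/s = 1 + c
    bounds k s^k by 1/c. *)
Lemma cvg_mulrn_expr (r : R) : 0 <= r < 1 ->
  (fun k : nat => k%:R * r ^+ k) @ \oo --> 0.
Proof.
move=> /andP[r0 r1]; pose s := Num.sqrt r.
have s1 : s < 1 by rewrite -sqrtr1 ltr_sqrt.
have [s0|s0] := ltP 0 s; last first.
  have -> : (fun k : nat => k%:R * r ^+ k) = cst 0.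
    apply/funext => -[|k]; first by rewrite mul0r.
    suff -> : r = 0 by rewrite expr0n mulr0.
    by apply/eqP; rewrite eq_le r0 -sqrtr_eq0 eq_le s0 sqrtr_ge0.
  exact: cvg_cst.
pose c := s^-1 - 1; have c0 : 0 < c by rewrite subr_gt0 invf_gt1.
have ks k : k%:R * s ^+ k <= c^-1.
  rewrite -ler_pdivlMr ?exprn_gt0// -exprVn mulrC ler_pdivlMr//.
  have c1 : 1 + c = s^-1 by rewrite addrC subrK.
  have := @bernoulli_add c k (ltW c0); rewrite c1.
  by apply: le_trans; rewrite lerDr.
have s_lt1 : `|s| < 1 by rewrite ger0_norm// ltW.
have := cvg_geometric c^-1 s_lt1.
apply: squeeze_cvgr (@cvg_cst _ _ _ _ _).
near=> k; rewrite mulr_ge0 ?exprn_ge0//= /geometric /=.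
by rewrite -[in X in X ^+ k](sqr_sqrtr r0) -exprM mulnC exprM expr2 mulrA ler_wpM2r// exprn_ge0// ltW.
Unshelve. all: by end_near. Qed.

(* polynomials in x converging to the indicator of x < t, as in the
   Brosowski-Deutsch proof of the Stone-Weierstrass theorem; the factor k in
   the exponent forces the limit 0 also at x = t *)
Definition threshold_seq t (k : nat) x : R :=
  (1 - x ^+ k) ^+ (k * (Num.truncn (t^-1 ^+ k)).+1).

Lemma threshold_seq_itv t k x : 0 <= x <= 1 -> 0 <= threshold_seq t k x <= 1.
Proof.
move=> /andP[x0 x1]; have xk : 0 <= 1 - x ^+ k <= 1.
  by rewrite subr_ge0 exprn_ile1//= lerBlDr lerDl exprn_ge0.
by case/andP: xk => *; rewrite exprn_ge0// exprn_ile1.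
Qed.

(** Let m be the outer exponent, y = x^k and r = x / t. If x < t, then m y <= 2 k r^k, so Bernoulli
    gives (1 - y)^m >= 1 - 2 k r^k. If x >= t, then m y >= k, and (1 - y)^m (1 + y)^m <= 1 gives (1
    - y)^m <= 1 / (k + 1). *)
Lemma threshold_seq_cvg t x : 0 < t <= 1 -> 0 <= x <= 1 ->
  (fun k => threshold_seq t k x) @ \oo --> ((x < t)%R%:R : R).
Proof.
move=> /andP[t0 t1] x01; have /andP[x0 x1] := x01.
have xk01 k : 0 <= x ^+ k <= 1 by rewrite exprn_ge0//= exprn_ile1.
have [xt|tx] := ltP x t.
  pose r := x / t; have r01 : 0 <= r < 1.
    by rewrite ltr_pdivrMr// mul1r xt divr_ge0// ltW.
  have xr : x <= r by rewrite /r ler_pdivlMr// ler_piMr.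
  have lim1 : (fun k : nat => 1 - 2 * (k%:R * r ^+ k)) @ \oo --> (1 : R).
    rewrite -[X in _ --> X]subr0 -[X in _ --> _ - X](mulr0 2).
    apply: cvgB; first exact: cvg_cst.
    by apply: cvgM; [exact: cvg_cst|exact: cvg_mulrn_expr].
  apply: squeeze_cvgr lim1 (@cvg_cst _ _ _ _ _).
  near=> k; have /andP[_ ->] := threshold_seq_itv t k x01; rewrite andbT.
  apply: le_trans (bernoulli_sub _ (xk01 k)); rewrite lerD2l lerN2.
  rewrite natrM -!mulrA [leRHS]mulrCA ler_wpM2l// -natr1 mulrDl mul1r.
  have -> : 2 * r ^+ k = r ^+ k + r ^+ k by rewrite mulr_natl mulr2n.
  rewrite lerD//.
    apply: (@le_trans _ _ (t^-1 ^+ k * x ^+ k)).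
      rewrite ler_wpM2r ?exprn_ge0//.
      by rewrite truncn_le exprn_ge0// invr_ge0 ltW.
    by rewrite -exprMn mulrC.
  by rewrite lerXn2r// ?nnegrE//; case/andP: r01.
have lim0 : (fun k : nat => k.+1%:R^-1) @ \oo --> (0 : R) by exact: cvg_harmonic.
apply: squeeze_cvgr (@cvg_cst _ _ _ _ _) lim0.
near=> k; have /andP[-> _] := threshold_seq_itv t k x01; rewrite /=.
rewrite /threshold_seq; set m := (k * _)%N; set y := x ^+ k.
have /andP[y0 y1] : 0 <= y <= 1 by exact: xk01.
have km : k%:R <= m%:R * y.
  rewrite natrM -mulrA ler_peMr//.
  apply: (@le_trans _ _ (t^-1 ^+ k * t ^+ k)).
    by rewrite -exprMn mulVf ?expr1n// gt_eqF.
  have t0' := ltW t0.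
  apply: ler_pM; rewrite ?exprn_ge0 ?invr_ge0//; first exact/ltW/truncnS_gt.
  by rewrite lerXn2r ?nnegrE.
rewrite -[leRHS]mul1r ler_pdivlMr//.
apply: (@le_trans _ _ ((1 - y) ^+ m * (1 + y) ^+ m)).
  rewrite ler_wpM2l ?exprn_ge0 ?subr_ge0//.
  by apply: le_trans (bernoulli_add _ y0); rewrite -natr1 addrC lerD2l.
rewrite -exprMn exprn_ile1//; first by rewrite mulr_ge0 ?subr_ge0// addr_ge0.
by rewrite -subr_sqr expr1n lerBlDr lerDl sqr_ge0.
Unshelve. all: by end_near. Qed.

(** The square of sin (pi (f - a / 2)): a trigonometric polynomial of degree one in f, symmetric
    about a / 2, with equal values at 0 and a. Its sublevel set at that common value is an open
    arc. *)
Definition arc_height a f := (1 - cos (2 * pi * (f - a / 2))) / 2.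

Lemma arc_height_itv a f : 0 <= arc_height a f <= 1.
Proof.
have := cos_le1 (2 * pi * (f - a / 2)); have := cos_geN1 (2 * pi * (f - a / 2)).
by rewrite /arc_height; move: (cos _) => c; lra.
Qed.

Lemma arc_height_lt a f : 0 < a < 1 -> 0 <= f < 1 ->
  (arc_height a f < arc_height a 0) = (0 < f < a).
Proof.
move=> /andP[a0 a1] /andP[f0 f1]; rewrite /arc_height ltr_pM2r// ltrD2l ltrN2.
have pi0 : 0 < pi :> R by exact: pi_gt0.
have pi0' := ltW pi0.
have piM (z : R) : 0 <= z <= 1 -> pi * z \in `[0, pi :> R].
  by move=> /andP[z0 z1]; rewrite in_itv/= mulr_ge0//= ler_piMr.
have -> : 2 * pi * (0 - a / 2) = - (pi * a) by lra.
rewrite cosN; set v := 2 * pi * _.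
have va : pi * a \in `[0, pi] by apply: piM; lra.
have vE : v = pi * (2 * f - a) by rewrite /v; lra.
(* The angle [v] lies between - pi and 2 pi. Parity and periodicity fold it into [0, pi], where the
   cosine is strictly decreasing. *)
have [v0|v0] := leP (2 * f) a.
  have -> : cos v = cos (pi * (a - 2 * f)).
    by rewrite -(cosN v) vE -mulrN opprB.
  rewrite ltr_cos//; last by apply: piM; lra.
  rewrite ltr_pM2l//; lra.
have [v1|v1] := leP (2 * f - a) 1.
  rewrite vE ltr_cos//; last by apply: piM; lra.
  rewrite ltr_pM2l//; lra.
have -> : cos v = cos (pi * (2 - (2 * f - a))).
  rewrite -(cosN v) -(cosD2pi (- v)) vE; congr cos.
  by rewrite mulr2n; lra.
rewrite ltr_cos//; last by apply: piM; lra.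
rewrite ltr_pM2l//; lra.
Qed.

End Threshold.

Section BoundedFunctions.
Context d (X : measurableType d) (R : realType) (mu : {measure set X -> \bar R}).
Implicit Types (w phi psi : X -> R).

Definition bounded_mfun phi :=
  measurable_fun setT phi /\ exists M, forall x, `|phi x| <= M.

Lemma bounded_mfun_cst c : bounded_mfun (fun=> c).
Proof. by split; [exact: measurable_cst|exists `|c|]. Qed.

Lemma bounded_mfunD phi psi : bounded_mfun phi -> bounded_mfun psi ->
  bounded_mfun (fun x => phi x + psi x).
Proof.
move=> [mphi [M phiM]] [mpsi [N psiN]]; split; first exact: measurable_funD.
by exists (M + N) => x; rewrite (le_trans (ler_normD _ _))// lerD.
Qed.

Lemma bounded_mfunM phi psi : bounded_mfun phi -> bounded_mfun psi ->
  bounded_mfun (fun x => phi x * psi x).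
Proof.
move=> [mphi [M phiM]] [mpsi [N psiN]]; split; first exact: measurable_funM.
by exists (M * N) => x; rewrite normrM ler_pM.
Qed.

Lemma bounded_mfun_indic (A : set X) : measurable A -> bounded_mfun \1_A.
Proof.
move=> mA; split; first exact: measurable_indic.
by exists 1 => x; rewrite indicE; case: (_ \in _); rewrite ?normr1 ?normr0.
Qed.

Lemma integrable_bounded_mfun w phi : mu.-integrable setT (EFin \o w) ->
  bounded_mfun phi -> mu.-integrable setT (EFin \o (fun x => w x * phi x)).
Proof.
move=> iw [mphi [M phiM]].
have mw : measurable_fun setT w by apply/measurable_EFinP; exact: measurable_int iw.
apply: (le_integrable _ _ _ (integrableZr measurableT M iw)) => //.
  by apply/measurable_EFinP; exact: measurable_funM.
move=> x _ /=; rewrite lee_fin !normrM ler_wpM2l//.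
by rewrite (le_trans (phiM x))// ler_norm.
Qed.

Lemma Rintegral_eq0 w : mu.-integrable setT (EFin \o w) ->
  \int[mu]_x w x = 0 <-> (\int[mu]_x (w x)%:E = 0)%E.
Proof.
move=> iw; rewrite /Rintegral; split=> [i0|->//].
by rewrite -[LHS]fineK ?i0//; exact: integrable_fin_num.
Qed.

(** Dominated convergence, with dominating function |w M|. *)
Lemma bounded_mfun_lim w (phi_ : nat -> X -> R) phi M :
  mu.-integrable setT (EFin \o w) ->
  (forall k, measurable_fun setT (phi_ k)) ->
  (forall k x, `|phi_ k x| <= M) ->
  (forall x, (fun k => phi_ k x) @ \oo --> phi x) ->
  bounded_mfun phi /\
  ((forall k, \int[mu]_x (w x * phi_ k x) = 0) -> \int[mu]_x (w x * phi x) = 0).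
Proof.
move=> iw mphi_ phiM lim.
have mw : measurable_fun setT w by apply/measurable_EFinP; exact: measurable_int iw.
have mphi : measurable_fun setT phi.
  by apply: (measurable_fun_cvg mphi_) => x _; exact: lim.
have bphi : bounded_mfun phi.
  split => //; exists M => x.
  have : (fun k => `|phi_ k x|) @ \oo --> `|phi x| by exact: cvg_norm.
  move=> nlim; rewrite -(cvg_lim _ nlim)//; apply: limr_le; first exact: cvgP nlim.
  exact: nearW.
have bphi_ k : bounded_mfun (phi_ k) by split => //; exists M.
split => // int0; apply/Rintegral_eq0; first exact: integrable_bounded_mfun.
have [] := @dominated_convergence _ _ _ mu setT measurableT
  (fun k x => (w x * phi_ k x)%:E) (fun x => (w x * phi x)%:E)
  (fun x => `|w x * M|%:E).
- by move=> k; apply/measurable_EFinP; exact: measurable_funM.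
- by apply/measurable_EFinP; exact: measurable_funM.
- apply: aeW => x _; apply: cvg_EFin; first by near=> k.
  by apply: cvgM; [exact: cvg_cst|exact: lim].
- apply: (le_integrable _ _ _ (integrableZr measurableT M iw)) => //.
    apply/measurable_EFinP; apply: measurableT_comp => //.
    by apply: measurable_funM => //; exact: measurable_cst.
  by move=> x _ /=; rewrite normr_id.
- apply: aeW => x k _; rewrite lee_fin !normrM ler_wpM2l//.
  by rewrite (le_trans (phiM k x))// ler_norm.
move=> _ _; rewrite (_ : (fun k => _) = cst 0%E); last first.
  by apply/funext => k; apply/Rintegral_eq0; first exact: integrable_bounded_mfun.
by move=> /cvg_lim <-//; rewrite lim_cst.
Unshelve. all: by end_near. Qed.

End BoundedFunctions.

Lemma trigD2piz (R : realType) (x : R) (k : int) :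
  cos (x + 2 * pi * k%:~R) = cos x /\ sin (x + 2 * pi * k%:~R) = sin x.
Proof.
have pos (y : R) (m : nat) :
    cos (y + 2 * pi * m%:R) = cos y /\ sin (y + 2 * pi * m%:R) = sin y.
  have -> : 2 * pi * m%:R = (pi *+ 2) *+ m :> R.
    by rewrite -[RHS]mulr_natr -[pi *+ 2]mulr_natl.
  by rewrite (periodicn (@cosD2pi R)) (periodicn (@sinD2pi R)).
case: k => m; first exact: pos.
have [c s] := pos (x + 2 * pi * (Negz m)%:~R) m.+1.
suff xE : x + 2 * pi * (Negz m)%:~R + 2 * pi * m.+1%:R = x.
  by rewrite -c -s xE.
by rewrite -addrA -mulrDr NegzE rmorphN /= addNr mulr0 addr0.
Qed.

(** * From orthogonality to trigonometric functions to orthogonality to periodic functions *)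

Section TrigOrthogonality.
Context (R : realType) (d : nat) (T : 'M[R]_d).
Hypothesis uT : T \in unitmx.
Local Notation X := 'cV[R]_d.
Local Notation Z := 'cV[int]_d.
Local Notation leb := (@lebesgue R d).

(** This is 2 pi <n, T^-1 x>. For T = B^-t it becomes 2 pi <B n, x>, the phase of a Gabor
    modulation. *)
Definition phase (n : Z) (x : X) : R :=
  2 * pi * \sum_i (n i 0)%:~R * lattice_coord T x i.

Definition trig (b : bool) (n : Z) (x : X) : R :=
  if b then cos (phase n x) else sin (phase n x).

Lemma phaseD n m x : phase (n + m) x = phase n x + phase m x.
Proof.
rewrite /phase -mulrDr -big_split /=; congr (_ * _); apply: eq_bigr => i _.
by rewrite mxE intrD mulrDl.
Qed.

Lemma phaseN n x : phase (- n) x = - phase n x.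
Proof.
rewrite /phase -mulrN -sumrN; congr (_ * _); apply: eq_bigr => i _.
by rewrite mxE rmorphN mulNr.
Qed.

Lemma phase0 x : phase 0 x = 0.
Proof. by rewrite /phase big1 ?mulr0// => i _; rewrite mxE mul0r. Qed.

Lemma phase_delta j x :
  phase (delta_mx j 0) x = 2 * pi * lattice_coord T x j.
Proof.
rewrite /phase (bigD1 j)//= mxE !eqxx mul1r big1 ?addr0// => i ij.
by rewrite mxE (negbTE ij) mul0r.
Qed.

Lemma trig_pt b n x z : trig b n (x + lattice_pt T z) = trig b n x.
Proof.
have -> y : trig b n y = (if b then cos else sin) (phase n y) by case: b.
have -> y : trig b n y = (if b then cos else sin) (phase n y) by case: b.
have -> : phase n (x + lattice_pt T z) =
    phase n x + 2 * pi * (\sum_i n i 0 * z i 0)%:~R.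
  rewrite /phase -mulrDr rmorph_sum -big_split /=; congr (_ * _).
  by apply: eq_bigr => i _; rewrite lattice_coord_pt// rmorphM mulrDr.
have [c s] := trigD2piz (phase n x) (\sum_i n i 0 * z i 0).
by case: b; [exact: c|exact: s].
Qed.

Lemma measurable_trig b n : measurable_fun setT (trig b n).
Proof.
have mphase : measurable_fun setT (phase n).
  apply: measurable_funM; first exact: measurable_cst.
  apply: measurable_sum => i; apply: measurable_funM; first exact: measurable_cst.
  exact: measurable_lattice_coord.
case: b; apply: measurableT_comp mphase.
  by apply: continuous_measurable_fun; exact: continuous_cos.
by apply: continuous_measurable_fun; exact: continuous_sin.
Qed.

Lemma bounded_mfun_trig b n : bounded_mfun (trig b n).
Proof.
split; first exact: measurable_trig.
by exists 1 => x; case: b; rewrite ler_norml ?cos_geN1 ?cos_le1 ?sin_geN1 ?sin_le1.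
Qed.

Lemma trigM b0 k b n x : trig b0 k x * trig b n x =
  if b0 then (trig b (n + k) x + trig b (n - k) x) / 2 else
  (if b then trig false (n + k) x - trig false (n - k) x
   else trig true (n - k) x - trig true (n + k) x) / 2.
Proof.
rewrite /trig !phaseD phaseN; case: b0; case: b.
- rewrite cosD cosB; lra.
- rewrite sinD sinB; lra.
- rewrite sinD sinB; lra.
- rewrite cosB cosD; lra.
Qed.

Context (w : X -> R).
Hypothesis iw : leb.-integrable setT (EFin \o w).
Hypothesis w_orth : forall b n, \int[leb]_x (w x * trig b n x) = 0.

(** Testing against every [trig b n], and not only against 1, makes the class stable under
    multiplication by trigonometric functions, through the product-to-sum identities. *)
Definition trig_orth (phi : X -> R) := bounded_mfun phi /\
  forall b n, \int[leb]_x (w x * (phi x * trig b n x)) = 0.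

Let int_orth phi b n : bounded_mfun phi ->
  leb.-integrable setT (EFin \o (fun x => w x * (phi x * trig b n x))).
Proof.
move=> bphi; apply: (integrable_bounded_mfun iw).
exact: (bounded_mfunM bphi (bounded_mfun_trig b n)).
Qed.

Lemma trig_orth_cst c : trig_orth (fun=> c).
Proof.
split; first exact: bounded_mfun_cst.
move=> b n; rewrite -[RHS](mulr0 c) -(w_orth b n) -RintegralZl//.
  by apply: eq_Rintegral => x _; rewrite mulrCA.
exact: (integrable_bounded_mfun iw (bounded_mfun_trig b n)).
Qed.

Lemma trig_orthD phi psi : trig_orth phi -> trig_orth psi ->
  trig_orth (fun x => phi x + psi x).
Proof.
move=> [bphi phi0] [bpsi psi0]; split; first exact: bounded_mfunD.
move=> b n; rewrite -[RHS](addr0 0) -{1}(phi0 b n) -(psi0 b n).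
rewrite -RintegralD//; [|exact: int_orth|exact: int_orth].
by apply: eq_Rintegral => x _; rewrite mulrDl mulrDr.
Qed.

Lemma trig_orthZ c phi : trig_orth phi -> trig_orth (fun x => c * phi x).
Proof.
move=> [bphi phi0]; split; first exact/bounded_mfunM/bphi/bounded_mfun_cst.
move=> b n; rewrite -[RHS](mulr0 c) -(phi0 b n) -RintegralZl//; last exact: int_orth.
by apply: eq_Rintegral => x _; rewrite -mulrA mulrCA.
Qed.

Lemma trig_orthB phi psi : trig_orth phi -> trig_orth psi ->
  trig_orth (fun x => phi x - psi x).
Proof.
move=> ophi opsi.
rewrite (_ : (fun x => _) = fun x => phi x + (-1) * psi x).
  exact/trig_orthD/trig_orthZ.
by apply/funext => x; rewrite mulN1r.
Qed.

Lemma trig_orthM b0 k phi : trig_orth phi ->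
  trig_orth (fun x => phi x * trig b0 k x).
Proof.
move=> [bphi phi0]; split.
  exact: (bounded_mfunM bphi (bounded_mfun_trig b0 k)).
have lin c b1 n1 b2 n2 : \int[leb]_x (w x *
    (phi x * ((trig b1 n1 x + c * trig b2 n2 x) / 2))) = 0.
  rewrite (_ : \int[leb]_x _ = \int[leb]_x (2^-1 * (w x * (phi x * trig b1 n1 x))
      + c / 2 * (w x * (phi x * trig b2 n2 x)))); last first.
    by apply: eq_Rintegral => x _; lra.
  have int c' b n : leb.-integrable setT
      (EFin \o (fun x => c' * (w x * (phi x * trig b n x)))).
    exact: (integrableZl measurableT c' (int_orth b n bphi)).
  rewrite RintegralD// !RintegralZl//; try exact: int_orth.
  by rewrite !phi0 !mulr0 addr0.
move=> b n; under eq_Rintegral do rewrite -mulrA trigM.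
case: b0; first by have := lin 1 b (n + k) b (n - k); under eq_Rintegral do rewrite mul1r.
by case: b; [have := lin (-1) false (n + k) false (n - k)|
  have := lin (-1) true (n - k) true (n + k)];
  under eq_Rintegral do rewrite mulN1r.
Qed.

Lemma trig_orth_lim (phi_ : nat -> X -> R) phi M :
  (forall k, trig_orth (phi_ k)) -> (forall k x, `|phi_ k x| <= M) ->
  (forall x, (fun k => phi_ k x) @ \oo --> phi x) -> trig_orth phi.
Proof.
move=> ophi_ phiM lim.
have mphi_ k : measurable_fun setT (phi_ k) by have [[]] := ophi_ k.
split; first by have [] := bounded_mfun_lim iw mphi_ phiM lim.
move=> b n; have [mt [N tN]] := bounded_mfun_trig b n.
have [] := @bounded_mfun_lim _ _ _ leb w (fun k x => phi_ k x * trig b n x)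
  (fun x => phi x * trig b n x) (M * N) iw.
- by move=> k; exact: measurable_funM.
- by move=> k x; rewrite normrM ler_pM.
- by move=> x; apply: cvgM; [exact: lim|exact: cvg_cst].
by move=> _; apply => k; have [_] := ophi_ k.
Qed.

(** Being a multiplier of the class is stronger than having the indicator in it, and is what makes
    finite unions immediate: multipliers can be applied one after the other. *)
Definition trig_orth_set (E : set X) := measurable E /\
  forall phi, trig_orth phi -> trig_orth (fun x => phi x * \1_E x).

Lemma trig_orth_setC E : trig_orth_set E -> trig_orth_set (~` E).
Proof.
move=> [mE oE]; split; first exact: measurableC.
move=> phi ophi; rewrite (_ : (fun x => _) = fun x => phi x - phi x * \1_E x).
  exact: (trig_orthB ophi (oE _ ophi)).
by apply/funext => x; rewrite !indicE in_setC; case: (x \in E) => /=; lra.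
Qed.

Lemma trig_orth_setU E F : trig_orth_set E -> trig_orth_set F ->
  trig_orth_set (E `|` F).
Proof.
move=> [mE oE] [mF oF]; split; first exact: measurableU.
move=> phi ophi; rewrite (_ : (fun x => _) = fun x =>
    phi x * \1_E x + (phi x - phi x * \1_E x) * \1_F x).
  exact: (trig_orthD (oE _ ophi) (oF _ (trig_orthB ophi (oE _ ophi)))).
apply/funext => x; rewrite !indicE in_setU.
by case: (x \in E); case: (x \in F) => /=; lra.
Qed.

Lemma trig_orth_set0 : trig_orth_set set0.
Proof.
split; first exact: measurable0.
move=> phi ophi; rewrite (_ : (fun x => _) = fun=> 0).
  exact: trig_orth_cst.
by apply/funext => x; rewrite indic0 mulr0.
Qed.

(** A countable union is the increasing limit of finite unions, and the class is closed under
    bounded pointwise limits. *)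
Lemma trig_orth_set_sigma : sigma_algebra setT trig_orth_set.
Proof.
split.
- exact: trig_orth_set0.
- by move=> E oE; rewrite setTD; exact: trig_orth_setC.
move=> F oF; split; first by apply: bigcupT_measurable => k; have [] := oF k.
move=> phi ophi.
have oU k : trig_orth_set (\big[setU/set0]_(i < k) F i).
  by apply: big_ind; [exact: trig_orth_set0|exact: trig_orth_setU|].
have [[_ [M phiM]] _] := ophi.
apply: (@trig_orth_lim (fun k x => phi x * \1_(\big[setU/set0]_(i < k) F i) x) _ M).
- by move=> k; have [_ oE] := oU k; exact: (oE _ ophi).
- move=> k x; rewrite normrM -[leRHS]mulr1 ler_pM// indicE.
  by case: (_ \in _); rewrite ?normr1 ?normr0.
move=> x; apply: cvgM; first exact: cvg_cst.
have [[k _ Fkx]|nF] := pselect ((\bigcup_k F k) x).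
  rewrite [X in _ --> X]indicE mem_set; last by exists k.
  apply: cvg_near_cst; near=> n; rewrite indicE mem_set//.
  rewrite -bigcup_mkord; exists k => //=; near: n; exact: nbhs_infty_gt.
rewrite indicE memNset//; apply: cvg_near_cst; apply: nearW => n.
rewrite indicE memNset// -bigcup_mkord => -[k _ Fkx]; apply: nF.
by exists k.
Unshelve. all: by end_near. Qed.

Lemma trig_orth_null N : lebesgue N = 0%E -> trig_orth_set N.
Proof.
move=> N0; have mN := lebesgue_null_measurable N0; split; first exact: mN.
move=> phi [bphi _]; split.
  exact: (bounded_mfunM bphi (bounded_mfun_indic R mN)).
have m0 : measurable_fun [set: X] (cst (0 : \bar R)%E) by exact: measurable_cst.
move=> b n; rewrite /Rintegral.
rewrite (ae_eq_integral (cst 0%E) _ measurableT _ m0); first by rewrite integral0.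
  apply/measurable_EFinP; apply: measurable_funM.
    by apply/measurable_EFinP; exact: measurable_int iw.
  apply: measurable_funM; last exact: measurable_trig.
  by apply: measurable_funM; [case: bphi|exact: measurable_indic].
exists N; split => // x /= /not_implyP[_ nx]; apply: contrapT => Nx; apply: nx.
by rewrite indicE memNset// mulr0 mul0r mulr0.
Qed.

Let arc j a : set X :=
  [set x | 0 < lattice_coord T (lattice_frac T x) j < a].

Lemma lattice_coord_frac x j :
  lattice_coord T (lattice_frac T x) j =
  lattice_coord T x j - (Num.floor (lattice_coord T x j))%:~R.
Proof.
by rewrite /lattice_frac -lattice_ptN lattice_coord_pt// !mxE rmorphN.
Qed.

(** The height [h] is a linear combination of 1 and two trigonometric functions, so every polynomial
    in [h] multiplies the class into itself. The threshold polynomials in [h] converge to the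
    indicator of the arc. *)
Lemma trig_orth_arc j a : 0 < a < 1 -> trig_orth_set (arc j a).
Proof.
move=> a01; pose h (x : X) := arc_height a (lattice_coord T x j).
have hE x : h x = 2^-1 * (1 - (cos (pi * a) * trig true (delta_mx j 0) x +
    sin (pi * a) * trig false (delta_mx j 0) x)).
  rewrite /h /arc_height /trig phase_delta.
  rewrite (_ : 2 * pi * (_ - _) = 2 * pi * lattice_coord T x j - pi * a); last by lra.
  rewrite cosB; lra.
have hfrac x : h x = arc_height a (lattice_coord T (lattice_frac T x) j).
  rewrite /h lattice_coord_frac /arc_height.
  set k := Num.floor _; set v := lattice_coord T x j.
  rewrite (_ : 2 * pi * (v - k%:~R - a / 2) =
    2 * pi * (v - a / 2) + 2 * pi * (- k)%:~R); last by rewrite rmorphN; lra.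
  by have [-> _] := trigD2piz (2 * pi * (v - a / 2)) (- k).
have oh phi : trig_orth phi -> trig_orth (fun x => phi x * h x).
  move=> ophi; rewrite (_ : (fun x => _) = fun x => 2^-1 * (phi x -
      (cos (pi * a) * (phi x * trig true (delta_mx j 0) x) +
       sin (pi * a) * (phi x * trig false (delta_mx j 0) x)))).
    apply: trig_orthZ; apply: (trig_orthB ophi).
    by apply: trig_orthD; apply: trig_orthZ; apply: trig_orthM; exact: ophi.
  by apply/funext => x; rewrite hE; lra.
have ohX phi k : trig_orth phi -> trig_orth (fun x => phi x * h x ^+ k).
  move=> ophi; elim: k => [|k IH].
    rewrite (_ : (fun x => _) = phi); first exact: ophi.
    by apply/funext => x; rewrite mulr1.
  rewrite (_ : (fun x => _) = fun x => (phi x * h x ^+ k) * h x).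
    exact: (oh _ IH).
  by apply/funext => x; rewrite exprSr mulrA.
have ohXX phi k m : trig_orth phi ->
    trig_orth (fun x => phi x * (1 - h x ^+ k) ^+ m).
  move=> ophi; elim: m => [|m IH].
    rewrite (_ : (fun x => _) = phi); first exact: ophi.
    by apply/funext => x; rewrite mulr1.
  rewrite (_ : (fun x => _) = fun x => (phi x * (1 - h x ^+ k) ^+ m) -
      (phi x * (1 - h x ^+ k) ^+ m) * h x ^+ k).
    exact: (trig_orthB IH (ohX _ k IH)).
  by apply/funext => x; rewrite exprSr; lra.
have h01 x : 0 <= h x <= 1 by exact: arc_height_itv.
have frac01 x : 0 <= lattice_coord T (lattice_frac T x) j < 1.
  by apply: lattice_cell_coord; exact: lattice_cell_frac.
have t01 : 0 < arc_height a 0 <= 1.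
  have /andP[_ ->] := arc_height_itv a 0; rewrite andbT lt_neqAle.
  have /andP[-> _] := arc_height_itv a 0; rewrite andbT.
  have : arc_height a (a / 2) < arc_height a 0.
    rewrite arc_height_lt//; case/andP: a01 => *; lra.
  have /andP[h0 _] := arc_height_itv a (a / 2).
  by move=> /(le_lt_trans h0); rewrite lt_neqAle => /andP[].
have arcE x : \1_(arc j a) x = ((h x < arc_height a 0)%R%:R : R).
  rewrite hfrac arc_height_lt// indicE; congr ((nat_of_bool _)%:R).
  by apply/idP/idP; rewrite inE.
split.
  rewrite (_ : arc j a = h @^-1` `]-oo, arc_height a 0[); last first.
    apply/seteqP; split => x; rewrite /arc /= in_itv/= hfrac arc_height_lt//.
  rewrite -[X in measurable X]setTI.
  have mh : measurable_fun setT h.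
    have [[]] := oh (fun=> 1) (trig_orth_cst 1).
    rewrite (_ : (fun x => _) = h); first exact.
    by apply/funext => x; rewrite mul1r.
  by apply: mh => //; exact: measurable_itv.
move=> phi ophi; have [[_ [M phiM]] _] := ophi.
apply: (@trig_orth_lim (fun k x => phi x * threshold_seq (arc_height a 0) k (h x)) _ M).
- by move=> k; exact: (ohXX _ _ _ ophi).
- move=> k x; rewrite normrM -[leRHS]mulr1 ler_pM//.
  by have /andP[? ?] := threshold_seq_itv (arc_height a 0) k (h01 x); rewrite ger0_norm.
move=> x; apply: cvgM; first exact: cvg_cst.
by rewrite arcE; exact: threshold_seq_cvg.
Qed.

(* [trig_orth_set] as a measurable structure: coordinates of [lattice_frac] are
   measurable for it, hence so is every periodic Borel function *)
Let S : measurableType _ := g_sigma_algebraType trig_orth_set.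

Let S_measurable (E : set S) : measurable E <-> trig_orth_set E.
Proof.
by rewrite [X in X E](measurable_g_measurableTypeE trig_orth_set_sigma).
Qed.

Lemma trig_orth_frac_coord j : measurable_fun [set: S]
  (fun x => lattice_coord T (lattice_frac T x) j : measurableTypeR R).
Proof.
pose f x := lattice_coord T (lattice_frac T x) j.
have f01 x : 0 <= f x < 1.
  by apply: lattice_cell_coord; exact: lattice_cell_frac.
have SC (E : set S) : measurable E -> measurable (~` E) by exact: measurableC.
(* The arcs omit the value 0 and together cover all positive values below 1, so the complement of
   their union is the zero set. The offset 2 keeps each length strictly between 0 and 1. *)
have S0 : measurable ([set x | f x = 0] : set S).
  rewrite (_ : [set _ | _] = ~` \bigcup_k arc j (1 - k.+2%:R^-1)).
    apply: SC; apply: bigcupT_measurable => k; apply/S_measurable.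
    by apply: trig_orth_arc; rewrite subr_gt0 invf_lt1// ltr1n/= ltrBlDr ltrDl.
  apply/seteqP; split => x /=.
    by move=> fx [k _]; rewrite /arc /= -/(f x) fx ltxx.
  have /andP[fx0 fx1] := f01 x.
  move=> nf; apply/eqP; rewrite eq_le fx0 andbT leNgt; apply/negP => fx.
  have fx1' : 0 < 1 - f x by rewrite subr_gt0.
  apply: nf; exists (Num.truncn (1 - f x)^-1) => //; rewrite /arc /= -/(f x) fx /=.
  rewrite ltrBrDr -ltrBrDl invf_plt ?posrE// (lt_trans (truncnS_gt _))//.
  by rewrite ltr_nat.
apply: (measurability _ (RGenInftyO.measurableE R)) => //.
move=> /= _ [_ [a ->] <-]; rewrite setTI.
have [a0|a0] := leP a 0.
  rewrite (_ : _ @^-1` _ = set0)//; apply/seteqP; split => x //=.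
  by rewrite in_itv/= -/(f x) => /lt_le_trans/(_ a0); have /andP[/le_gtF ->] := f01 x.
have [a1|a1] := leP 1 a.
  rewrite (_ : _ @^-1` _ = setT)//; apply/seteqP; split => x //= _.
  by rewrite in_itv/= -/(f x) (lt_le_trans _ a1)//; have /andP[] := f01 x.
rewrite (_ : _ @^-1` _ = [set x | f x = 0] `|` arc j a).
  apply: measurableU => //; apply/S_measurable.
  by apply: trig_orth_arc; rewrite a0.
apply/seteqP; split => x; rewrite /arc /= in_itv/= -/(f x).
  move=> fa; have /andP[] := f01 x; rewrite le_eqVlt => /predU1P[<-|f0] _; first by left.
  by right; rewrite f0.
by case=> [->//|/andP[]].
Qed.

Lemma trig_orth_frac E : measurable E ->
  trig_orth_set ((lattice_frac T) @^-1` E).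
Proof.
have [TO0 TOC TOU] := trig_orth_set_sigma.
move: E; apply: (@lebesgue_measurable_ind _ _ [set E | trig_orth_set (lattice_frac T @^-1` E)]).
- split; first by rewrite /= preimage_set0.
    by move=> E oE; rewrite /= setTD preimage_setC -setTD; exact: TOC.
  by move=> F oF; rewrite /= preimage_bigcup; exact: TOU.
- move=> i B mB; apply/S_measurable; rewrite -comp_preimage.
  rewrite -[X in measurable X]setTI.
  have mi : measurable_fun [set: S]
      ((fun x : X => x i 0 : measurableTypeR R) \o lattice_frac T).
    rewrite (_ : _ \o _ = fun x => \sum_j T i j * lattice_coord T (lattice_frac T x) j).
      apply: measurable_sum => j; apply: measurable_funM; first exact: measurable_cst.
      exact: trig_orth_frac_coord.
    by apply/funext => x /=; rewrite -{1}(mulKVmx uT (lattice_frac T x)) mxE.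
  exact: mi.
- move=> N N0; apply: trig_orth_null.
  apply: lebesgue_null_sub (lebesgue_orbit_null T N0) => x Nx.
  by exists (- lattice_floor T x); rewrite lattice_ptN.
Qed.

(** Layer-cake approximation: for psi with values in [0, 1], the average [g k] of the indicators of
    k + 1 superlevel sets is psi rounded down to a multiple of 1 / (k + 1), so it converges
    uniformly. *)
Lemma trig_orth_periodic (psi : X -> R) : bounded_mfun psi ->
  trig_orth (psi \o lattice_frac T).
Proof.
have layer k (m : nat) : (m <= k)%N -> \sum_(i < k) (i < m)%N%:R = m%:R :> R.
  elim: k => [|k IH]; first by rewrite leqn0 => /eqP ->; rewrite big_ord0.
  rewrite big_ord_recr /= leq_eqVlt => /predU1P[->|mk]; last first.
    by rewrite IH// ltnNge -ltnS mk addr0.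
  rewrite ltnSn -natr1; congr (_ + _).
  rewrite (eq_bigr (fun=> 1)) ?sumr_const ?card_ord// => i _.
  by rewrite (leq_trans (ltn_ord i)).
wlog psi01 : psi / forall x, 0 <= psi x <= 1.
  move=> hyp bpsi; have [mpsi [M psiM]] := bpsi.
  (* [c] bounds |psi|, and the added 1 keeps it positive; (psi + c) / (2 c) then has values in
     [0, 1]. *)
  pose c := `|M| + 1; have c0 : 0 < c by rewrite ltr_wpDl.
  have psic x : `|psi x| <= c.
    by rewrite (le_trans (psiM x))// (le_trans (ler_norm _))// lerDl.
  pose psi' x := (2 * c)^-1 * (psi x + c).
  have -> : psi \o lattice_frac T = fun x =>
      2 * c * (psi' \o lattice_frac T) x - c.
    by apply/funext => x; rewrite /psi' /= mulrA mulfV ?mul1r ?addrK// lt0r_neq0// mulr_gt0.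
  apply: trig_orthB; last exact: trig_orth_cst.
  apply: trig_orthZ; apply: hyp.
    move=> x; rewrite mulr_ge0/=; first last.
    - by have := psic x; rewrite ler_norml => /andP[? _]; lra.
    - by rewrite invr_ge0; lra.
    rewrite ler_pdivrMl ?mulr1; last by lra.
    by have := psic x; rewrite ler_norml => /andP[_ ?]; lra.
  apply: bounded_mfunM; first exact: bounded_mfun_cst.
  exact: (bounded_mfunD bpsi (bounded_mfun_cst _ c)).
move=> [mpsi _].
pose E k i : set X := [set x | i.+1%:R <= k.+1%:R * psi x].
have mE k i : measurable (E k i).
  rewrite (_ : E k i = psi @^-1` `[i.+1%:R / k.+1%:R, +oo[).
    by rewrite -[X in measurable X]setTI; apply: mpsi => //; exact: measurable_itv.
  apply/seteqP; split => x; rewrite /E /= in_itv/= andbT ler_pdivrMr//.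
    by rewrite mulrC.
  by rewrite mulrC.
pose g k x : R := k.+1%:R^-1 * \sum_(i < k.+1) \1_(lattice_frac T @^-1` E k i) x.
have gE k x : g k x =
    k.+1%:R^-1 * (Num.truncn (k.+1%:R * psi (lattice_frac T x)))%:R.
  rewrite /g; congr (_ * _); set y := _ * psi _.
  have /andP[y0 y1] : 0 <= psi (lattice_frac T x) <= 1 by exact: psi01.
  have ky0 : 0 <= y by rewrite mulr_ge0.
  rewrite -(@layer k.+1 (Num.truncn y)).
    apply: eq_bigr => i _; rewrite indicE truncn_gt_nat; congr ((nat_of_bool _)%:R).
    by apply/idP/idP; rewrite inE.
  rewrite -(ler_nat R) (le_trans (_ : _ <= y))//; first by rewrite truncn_le.
  by rewrite ler_piMr.
have g1 k x : `|g k x - psi (lattice_frac T x)| <= k.+1%:R^-1.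
  have /andP[y0 y1] : 0 <= psi (lattice_frac T x) <= 1 by exact: psi01.
  set y := psi _ in y0 y1 *.
  have /andP[t1 t2] := truncn_itv (mulr_ge0 (ler0n R k.+1) y0).
  have k0 : 0 < k.+1%:R^-1 :> R by rewrite invr_gt0.
  set m : R := (Num.truncn _)%:R in t1 *; rewrite -[X in _ < X]natr1 -/m in t2.
  have gm : k.+1%:R * g k x = m by rewrite gE mulrA mulfV ?mul1r// pnatr_eq0.
  have k1 : k.+1%:R * k.+1%:R^-1 = 1 :> R by rewrite mulfV ?pnatr_eq0.
  rewrite ler_norml; apply/andP; split; rewrite -(ler_pM2l (ltr0Sn R k)).
    by rewrite mulrN k1 mulrBr gm; move: t1 t2; move: (_ * y) => *; lra.
  by rewrite k1 mulrBr gm; move: t1 t2; move: (_ * y) => *; lra.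
apply: (@trig_orth_lim g _ 2).
- move=> k; rewrite /g; apply: trig_orthZ.
  elim: (k.+1) => [|n IH].
    rewrite (_ : (fun x => _) = fun=> 0); first exact: trig_orth_cst.
    by apply/funext => x; rewrite big_ord0.
  rewrite (_ : (fun x => _) = fun x =>
     \sum_(i < n) \1_(lattice_frac T @^-1` E k i) x +
     1 * \1_(lattice_frac T @^-1` E k n) x).
    have [_ oE] := trig_orth_frac (mE k n).
    exact: (trig_orthD IH (oE _ (trig_orth_cst 1))).
  by apply/funext => x; rewrite big_ord_recr mul1r.
- move=> k x; have /andP[y0 y1] : 0 <= psi (lattice_frac T x) <= 1 by exact: psi01.
  rewrite -(subrK (psi (lattice_frac T x)) (g k x)) (le_trans (ler_normD _ _))//.
  have k1 : k.+1%:R^-1 <= 1 :> R by rewrite invf_le1// ler1n.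
  by rewrite (ger0_norm y0) [leRHS](_ : 2 = 1 + 1)// lerD// (le_trans (g1 k x)).
move=> x /=; apply/cvgrPdist_le => e e0; near=> k.
rewrite distrC (le_trans (g1 k x))// ltW//; near: k.
exact: near_infty_natSinv_lt (PosNum e0).
Unshelve. all: by end_near. Qed.

End TrigOrthogonality.

Lemma esumZl (R : realType) (I : countType) (k : R) (a : I -> \bar R) :
  (forall i, 0 <= a i)%E -> 0 <= k ->
  (\esum_(i in [set: I]) (k%:E * a i) = k%:E * \esum_(i in [set: I]) a i)%E.
Proof.
move=> a0 k0; rewrite !esum_countType//; last by move=> i; rewrite mule_ge0.
rewrite -nneseriesZl; last by move=> i _; case: (pickle_inv i).
by apply: eq_eseriesr => i _; case: (pickle_inv i) => //=; rewrite mule0.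
Qed.

(** * Integrals of periodic functions and constancy of the level *)

Section PeriodicIntegrals.
Context (R : realType) (d : nat) (T : 'M[R]_d).
Hypothesis uT : T \in unitmx.
Local Notation X := 'cV[R]_d.
Local Notation Z := 'cV[int]_d.
Local Notation leb := (@lebesgue R d).
Local Notation P := (lattice_cell T).

Lemma integrable_indic_lebesgue (A : set X) : measurable A ->
  (lebesgue A < +oo)%E -> leb.-integrable setT (EFin \o \1_A).
Proof.
move=> mA Aoo; apply/integrableP; split.
  by apply/measurable_EFinP; exact: measurable_indic.
rewrite (eq_integral (fun x => (\1_A x)%:E)).
  by rewrite integral_indic// setIT.
by move=> x _ /=; rewrite ger0_norm// indicE.
Qed.

Lemma Rintegral_indic_lebesgue (A : set X) : measurable A ->
  \int[leb]_x \1_A x = fine (lebesgue A).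
Proof. by move=> mA; rewrite /Rintegral integral_indic// setIT. Qed.

Lemma integral_indicM (A : set X) (f : X -> R) :
  (\int[leb]_x (\1_A x * f x)%:E = \int[leb]_(x in A) (f x)%:E)%E.
Proof.
rewrite [RHS]integral_mkcond; apply: eq_integral => x _.
by rewrite patchE indicE; case: ifP => _; rewrite ?mul1r ?mul0r.
Qed.

(** After unfolding over the cell, periodicity pulls [f] out of the sum, and what is left is the
    count of [A]. *)
Lemma ge0_integral_periodic (A : set X) (c : R) (f : X -> R) :
  measurable A -> 0 <= c -> {ae leb, forall x, lattice_count T A x = c%:E} ->
  measurable_fun setT f -> (forall x, 0 <= f x) ->
  (forall x z, f (x + lattice_pt T z) = f x) ->
  (\int[leb]_x (\1_A x * f x)%:E = c%:E * \int[leb]_x (\1_P x * f x)%:E)%E.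
Proof.
move=> mA c0 Ac mf f0 fper.
have mP := measurable_lattice_cell T.
rewrite (integral_unfold uT); first last.
- by move=> x; rewrite lee_fin mulr_ge0// indicE.
- by apply/measurable_EFinP; apply: measurable_funM => //; exact: measurable_indic.
rewrite integral_indicM.
transitivity (\int[leb]_(x in P) ((f x)%:E * lattice_count T A x))%E.
  apply: eq_integral => x _; rewrite -esumZl//.
  by apply: eq_esum => z _; rewrite fper -EFinM mulrC.
have mfP : measurable_fun P (EFin \o f).
  by apply/measurable_EFinP; exact: measurable_funTS.
have f0' x : P x -> (0 <= (EFin \o f) x)%E by rewrite lee_fin.
rewrite -(ge0_integralZl_EFin leb mP f0' mfP c0).
have count0 x : (0 <= lattice_count T A x)%E.
  by apply: esum_ge0 => z _; rewrite lee_fin indicE.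
apply: ge0_ae_eq_integral; first exact: mP.
- apply: emeasurable_funM; first exact: mfP.
  exact: (measurable_funTS (measurable_lattice_count T mA)).
- by apply: emeasurable_funM; [exact: measurable_cst|exact: mfP].
- by move=> x _; rewrite mule_ge0// lee_fin.
- by move=> x _; rewrite mule_ge0// lee_fin.
- by apply: filterS Ac => x -> _; rewrite muleC.
Qed.

Lemma Rintegral_periodic (A : set X) (c : R) (f : X -> R) :
  measurable A -> (lebesgue A < +oo)%E ->
  0 <= c -> {ae leb, forall x, lattice_count T A x = c%:E} ->
  bounded_mfun f -> (forall x z, f (x + lattice_pt T z) = f x) ->
  \int[leb]_x (\1_A x * f x) = c * \int[leb]_x (\1_P x * f x).
Proof.
move=> mA Aoo c0 Ac bf fper; have [mf [M fM]] := bf.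
have mP := measurable_lattice_cell T; have Poo := lattice_cell_fin uT.
have iA := integrable_indic_lebesgue mA Aoo.
have iP := integrable_indic_lebesgue mP Poo.
have ge0 (g : X -> R) : bounded_mfun g -> (forall x, 0 <= g x) ->
    (forall x z, g (x + lattice_pt T z) = g x) ->
    \int[leb]_x (\1_A x * g x) = c * \int[leb]_x (\1_P x * g x).
  move=> bg g0 gper; have [mg _] := bg.
  rewrite /Rintegral (ge0_integral_periodic mA c0 Ac mg g0 gper) fineM//.
  by apply: integrable_fin_num => //; exact: (integrable_bounded_mfun iP bg).
(* Adding |M| makes the integrand nonnegative and keeps it periodic; the constant is then treated as
   a second nonnegative periodic function. *)
have shift B : leb.-integrable setT (EFin \o \1_B) ->
    \int[leb]_x (\1_B x * f x) = \int[leb]_x (\1_B x * (f x + `|M|)) -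
      \int[leb]_x (\1_B x * `|M|).
  move=> iB; rewrite -RintegralB//; first last.
  - exact: (integrable_bounded_mfun iB (bounded_mfun_cst _ _)).
  - exact: (integrable_bounded_mfun iB (bounded_mfunD bf (bounded_mfun_cst _ _))).
  by apply: eq_Rintegral => x _; rewrite mulrDr addrK.
rewrite (shift A iA) (shift P iP) mulrBr; congr (_ - _); apply: ge0.
- exact: (bounded_mfunD bf (bounded_mfun_cst _ _)).
- move=> x; have := fM x; rewrite ler_norml => /andP[? _].
  by have := ler_norm M; lra.
- by move=> x z; rewrite fper.
- exact: bounded_mfun_cst.
- by [].
- by [].
Qed.

Lemma integral_shift (s : X) (f : X -> \bar R) : measurable_fun setT f ->
  (\int[leb]_x f (x + s)%R = \int[leb]_x f x)%E.
Proof.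
move=> mf; rewrite integralE [RHS]integralE; congr (_ - _)%E.
- rewrite -(ge0_integral_shift s (measurable_funepos mf) (funepos_ge0 f)).
  by apply: eq_integral => x _; rewrite !funeposE.
- rewrite -(ge0_integral_shift s (measurable_funeneg mf) (funeneg_ge0 f)).
  by apply: eq_integral => x _; rewrite !funenegE.
Qed.

Lemma Rintegral_shift (s : X) (f : X -> R) : measurable_fun setT f ->
  \int[leb]_x f (x + s) = \int[leb]_x f x.
Proof.
move=> mf; rewrite /Rintegral; congr fine.
by apply: (integral_shift s (f := EFin \o f)); exact/measurable_EFinP.
Qed.

Lemma measurable_lattice_frac : measurable_fun setT (lattice_frac T : X -> X).
Proof.
move=> _ E mE; rewrite setTI.
rewrite (_ : _ @^-1` _ = \bigcup_(z in [set: Z])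
    ([set x | lattice_floor T x = z] `&` (fun x => x + (- lattice_pt T z)) @^-1` E)).
  apply: countable_bigcupT_measurable => // z.
  apply: measurableI; first exact: measurable_lattice_floor.
  by rewrite -[X in measurable X]setTI; exact: measurable_shift.
apply/seteqP; split => [x Ex|x [z _ [/= xz Ez]]].
  by exists (lattice_floor T x).
by rewrite /lattice_frac /= xz.
Qed.

(* every translate of the cell meets each coset exactly once *)
Lemma Rintegral_cell_shift (f : X -> R) (s : X) : bounded_mfun f ->
  (forall x z, f (x + lattice_pt T z) = f x) ->
  \int[leb]_x (\1_P x * f (x + s)) = \int[leb]_x (\1_P x * f x).
Proof.
move=> bf fper; have [mf _] := bf.
have mP := measurable_lattice_cell T; have Poo := lattice_cell_fin uT.
pose A := (fun x : X => x + - s) @^-1` P.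
have mA : measurable A.
  by rewrite -[X in measurable X]setTI; exact: measurable_shift.
have lA : lebesgue A = lebesgue P by exact: lebesgue_shift.
have A1 x : lattice_count T A x = 1%E.
  apply: (@lattice_count_uniq _ _ _ _ _ (- lattice_floor T (x - s))).
    by rewrite /A /= addrAC; apply/lattice_cell_pt.
  by move=> z; rewrite /A /= addrAC => /lattice_cell_pt ->.
have Aoo : (lebesgue A < +oo)%E by rewrite lA.
rewrite -[RHS]mul1r -(Rintegral_periodic mA Aoo ler01 _ bf fper); last exact: aeW.
have mAf : measurable_fun setT (fun x => \1_A x * f x).
  by apply: measurable_funM; [exact: measurable_indic|exact: mf].
rewrite -(Rintegral_shift s mAf).
apply: eq_Rintegral => x _; congr (_ * _); rewrite !indicE.
by congr ((nat_of_bool _)%:R); apply/idP/idP; rewrite !inE /A /= addrK.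
Qed.

(** A suitable translation changes the sign of the function, while the integral over the cell is
    invariant under translation of a periodic integrand. *)
Lemma Rintegral_cell_trig b n : n != 0 -> \int[leb]_x (\1_P x * trig T b n x) = 0.
Proof.
move=> n0; have [j nj] : exists j, n j 0 != 0.
  apply: contrapT => /forallNP nj; move/eqP : n0; apply; apply/colP => j.
  by rewrite mxE; apply/eqP; apply: contrapT => /negP; exact: nj.
(* Half a period along a direction with n j != 0: the phase grows by 2 pi times 1/2, that is by
   pi. *)
pose s : X := T *m ((2 * (n j 0)%:~R)^-1 *: delta_mx j 0).
have nj' : (n j 0)%:~R != 0 :> R by rewrite intr_eq0.
have phase_s x : phase T n (x + s) = phase T n x + pi.
  rewrite /phase.
  have -> : \sum_i (n i 0)%:~R * lattice_coord T (x + s) i =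
      \sum_i (n i 0)%:~R * lattice_coord T x i + 2^-1.
    under eq_bigr do rewrite /lattice_coord mulmxDr mxE mulrDr.
    rewrite big_split /=; congr (_ + _).
    rewrite (bigD1 j)//= big1 ?addr0 => [|i ij].
      by rewrite /s mulKmx// !mxE !eqxx mulr1 invfM mulrCA mulfV ?mulr1.
    by rewrite /s mulKmx// !mxE (negbTE ij) !mulr0.
  by rewrite mulrDr; congr (_ + _); lra.
have trig_s x : trig T b n (x + s) = - trig T b n x.
  by rewrite /trig phase_s; case: (b); rewrite ?cosDpi ?sinDpi.
have := Rintegral_cell_shift s (bounded_mfun_trig T b n) (trig_pt uT b n).
have mP := measurable_lattice_cell T; have Poo := lattice_cell_fin uT.
have iP := integrable_indic_lebesgue mP Poo.
under eq_Rintegral do rewrite trig_s mulrN -mulN1r.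
rewrite RintegralZl//; last exact: (integrable_bounded_mfun iP (bounded_mfun_trig T b n)).
by move: (\int[leb]_x _) => r; lra.
Qed.

(** [F] is supported in one translate of the cell, so composing it with the representative in that
    translate yields its periodic extension; almost every coset has c points in [A]. *)
Lemma Rintegral_frac (A : set X) (c : R) (F : X -> R) (z0 : Z) :
  measurable A -> (lebesgue A < +oo)%E ->
  0 <= c -> {ae leb, forall x, lattice_count T A x = c%:E} ->
  bounded_mfun F -> (forall x, F x != 0 -> lattice_cell T (x - lattice_pt T z0)) ->
  \int[leb]_x (\1_A x * F (lattice_frac T x + lattice_pt T z0)) =
  c * \int[leb]_x F x.
Proof.
move=> mA Aoo c0 Ac bF FP; have [mF [M FM]] := bF.
have bG : bounded_mfun (fun x => F (lattice_frac T x + lattice_pt T z0)).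
  split; last by exists M.
  apply: (measurableT_comp mF).
  exact: (measurableT_comp (measurable_shift _) measurable_lattice_frac).
have Gper x z : F (lattice_frac T (x + lattice_pt T z) + lattice_pt T z0) =
    F (lattice_frac T x + lattice_pt T z0) by rewrite lattice_frac_pt.
rewrite (Rintegral_periodic mA Aoo c0 Ac bG Gper); congr (_ * _).
rewrite -[RHS](Rintegral_shift (lattice_pt T z0))//; apply: eq_Rintegral => x _.
rewrite indicE; have [xP|/negP xP] := boolP (x \in P).
  by rewrite mul1r lattice_frac_cell//; rewrite inE in xP.
rewrite mul0r; apply/esym/eqP; apply: contrapT => /negP /FP.
by rewrite addrK => Px; apply: xP; rewrite inE.
Qed.

Lemma lattice_count_const (K : set X) : measurable K ->
  (lebesgue K < +oo)%E -> (0 < lebesgue K)%E ->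
  (forall b n, n != 0 -> \int[leb]_x (\1_K x * trig T b n x) = 0) ->
  {ae leb, forall x, lattice_count T K x =
    (fine (lebesgue K) / fine (lebesgue P))%:E}.
Proof.
move=> mK Koo K0 Kn.
have mP := measurable_lattice_cell T; have Poo := lattice_cell_fin uT.
have P0 : (0 < lebesgue P)%E := lattice_cell_pos uT K0.
have iP := integrable_indic_lebesgue mP Poo.
have iK := integrable_indic_lebesgue mK Koo.
set k := fine (lebesgue K); set p := fine (lebesgue P); set c := k / p.
have p0 : 0 < p by rewrite fine_gt0// P0.
have k0 : 0 < k by rewrite fine_gt0// K0.
have c0 : 0 <= c by rewrite divr_ge0// ltW.
(* The ratio [c] of the measures is forced by n = 0: it makes [w] orthogonal to constants too. For n
   != 0 both indicators are already orthogonal to the trigonometric functions. *)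
pose w x : R := \1_K x - c * \1_P x.
have icP : leb.-integrable setT (EFin \o (fun x => c * \1_P x)).
  exact: (integrableZl measurableT c iP).
have iw : leb.-integrable setT (EFin \o w).
  exact: (integrableB measurableT iK icP).
have w_int (phi : X -> R) : bounded_mfun phi -> \int[leb]_x (w x * phi x) =
    \int[leb]_x (\1_K x * phi x) - c * \int[leb]_x (\1_P x * phi x).
  move=> bphi; have iPphi := integrable_bounded_mfun iP bphi.
  rewrite -RintegralZl// -RintegralB//; first last.
  - exact: (integrableZl measurableT c iPphi).
  - exact: (integrable_bounded_mfun iK bphi).
  by apply: eq_Rintegral => x _; rewrite /w; lra.
have w_orth b n : \int[leb]_x (w x * trig T b n x) = 0.
  rewrite (w_int _ (bounded_mfun_trig T b n)).
  have [->|n0] := eqVneq n 0; last first.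
    by rewrite Kn// Rintegral_cell_trig// mulr0 subr0.
  have -> : trig T b 0 = fun=> b%:R :> R.
    by apply/funext => x; rewrite /trig phase0; case: b; rewrite ?cos0 ?sin0.
  rewrite RintegralZr// RintegralZr// !Rintegral_indic_lebesgue//.
  by rewrite -/k -/p /c mulrA divfK ?subrr// gt_eqF.
have mcount := measurable_lattice_count T mK.
have count0 x : (0 <= lattice_count T K x)%E.
  by apply: esum_ge0 => z _; rewrite lee_fin indicE.
have aeP : ae_eq leb P (cst c%:E) (lattice_count T K).
  apply: integral_ae_eq => //.
  - apply/integrableP; split; first exact: measurable_cst.
    rewrite (eq_integral (cst c%:E)) => [|x _]; last by rewrite /= ger0_norm.
    by rewrite integral_cst// lte_mul_pinfty.
  - exact: measurable_funTS.
  move=> D DP mD; rewrite integral_cst//.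
  have Doo : (lebesgue D < +oo)%E by exact: le_lt_trans (lebesgue_le DP) Poo.
  (* The periodic extension of the indicator of [D]. Orthogonality of [w] to it, once unfolded, says
     that the integral of the count over [D] is [c] times the measure of [D]. *)
  pose phi : X -> R := \1_D \o lattice_frac T.
  have [bphi ophi] := trig_orth_periodic uT iw w_orth (bounded_mfun_indic R mD).
  have wphi0 : \int[leb]_x (w x * phi x) = 0.
    rewrite -[RHS](ophi true 0); apply: eq_Rintegral => x _.
    by rewrite /trig phase0 cos0 mulr1.
  have Pphi : \int[leb]_x (\1_P x * phi x) = fine (lebesgue D).
    rewrite -(Rintegral_indic_lebesgue mD); apply: eq_Rintegral => x _.
    rewrite /phi /= indicE; have [xP|/negP xP] := boolP (x \in P).
      by rewrite inE in xP; rewrite lattice_frac_cell// mul1r.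
    rewrite mul0r indicE memNset// => /DP Dx; apply: xP; rewrite inE.
    exact: Dx.
  have Kphi : \int[leb]_x (\1_K x * phi x) = c * fine (lebesgue D).
    apply/eqP; rewrite -subr_eq0 -Pphi; apply/eqP.
    exact: (etrans (esym (w_int _ bphi)) wphi0).
  have {Kphi} : (\int[leb]_x (\1_K x * phi x)%:E = c%:E * lebesgue D)%E.
    rewrite -[lebesgue D]fineK ?ge0_fin_numE// -EFinM -Kphi fineK//.
    by apply: integrable_fin_num => //; exact: (integrable_bounded_mfun iK bphi).
  move=> <-; have [mphi _] := bphi.
  have phi0 x : 0 <= phi x by rewrite /phi /= indicE.
  rewrite (integral_unfold uT); first last.
  - by move=> x; rewrite lee_fin mulr_ge0// indicE.
  - apply/measurable_EFinP; apply: measurable_funM; last exact: mphi.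
    exact: measurable_indic.
  rewrite [LHS]integral_mkcond [RHS]integral_mkcond; apply: eq_integral => x _.
  rewrite !patchE; have [xP|/negP xP] := boolP (x \in P); last first.
    rewrite memNset// => /DP Dx; apply: xP; rewrite inE.
    exact: Dx.
  transitivity ((phi x)%:E * lattice_count T K x)%E.
    rewrite -esumZl//; apply: eq_esum => z _.
    by rewrite /phi /= lattice_frac_pt// -EFinM mulrC.
  rewrite inE in xP; rewrite /phi /= lattice_frac_cell// indicE.
  by case: ifP => _; rewrite ?mul1e ?mul0e.
have [N [mN N0 PN]] := aeP.
(* The equality is known almost everywhere in the cell. The count is periodic, so a failure at [x]
   is a failure at its representative in the cell. *)
exists [set x | exists z, N (x + lattice_pt T z)]; split.
- exact/lebesgue_null_measurable/lebesgue_orbit_null.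
- exact: lebesgue_orbit_null.
move=> x /= cx; exists (- lattice_floor T x); apply: PN => /= PNx; apply: cx.
rewrite -(lattice_count_pt T K x (- lattice_floor T x)).
by apply/esym/PNx/lattice_cell_pt.
Qed.

Lemma lattice_count_natural (K : set X) (x : X) (r : R) :
  lattice_count T K x = r%:E -> exists N : nat, r = N%:R.
Proof.
pose A := [set z | K (x + lattice_pt T z)].
have -> : lattice_count T K x = (\esum_(z in A) (1 : R)%:E)%E.
  rewrite [RHS]esum_mkcond; apply: eq_esum => z _; rewrite indicE.
  have -> : (x + lattice_pt T z \in K) = (z \in A) by apply/idP/idP; rewrite !inE.
  by case: ifP.
move=> Ar; have sumE (B : set Z) : finite_set B ->
    (\sum_(z \in B) (1 : R)%:E)%E = ((size (finmap.enum_fset (fset_set B)))%:R)%:E.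
  move=> finB; rewrite fsbig_finite//= sumEFin big_const_seq count_predT iter_addr.
  by rewrite addr0.
have [finA|infA] := pselect (finite_set A).
  exists (size (finmap.enum_fset (fset_set A))); apply: EFin_inj.
  by rewrite -Ar esum_fset// sumE.
(* Already finitely many points, more than r of them, would push the sum above r. *)
exfalso; have [B BA Bsize] := infinite_set_fset (Num.truncn r).+1 infA.
have : (((Num.truncn r).+1)%:R%:E <= r%:E)%E.
  rewrite -Ar; apply: esum_ge; apply: (ex_intro2 _ _ _ (conj (finite_fset B) BA)).
  rewrite sumE; last exact: finite_fset.
  by rewrite set_fsetK lee_fin ler_nat.
by rewrite lee_fin leNgt truncnS_gt.
Qed.

End PeriodicIntegrals.

(** * Parseval's identity *)

Section L2Space.
Context d (X : measurableType d) (R : realType) (mu : {measure set X -> \bar R}).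
Local Notation CRe := (@complex.Re R).
Local Notation CIm := (@complex.Im R).
Implicit Types (f g h : X -> R[i]) (u v : X -> R).

Definition normc2 (z : R[i]) : R := CRe z ^+ 2 + CIm z ^+ 2.

Definition sq_integrable u :=
  measurable_fun setT u /\ mu.-integrable setT (EFin \o (fun x => u x ^+ 2)).

(** Domination by u^2 + v^2. *)
Lemma integrable_mul u v : sq_integrable u -> sq_integrable v ->
  mu.-integrable setT (EFin \o (fun x => u x * v x)).
Proof.
move=> [mu_ iu] [mv iv].
apply: (le_integrable measurableT _ _ (integrableD measurableT iu iv)).
  by apply/measurable_EFinP; apply: measurable_funM.
move=> x _ /=; rewrite lee_fin normrM.
rewrite [leRHS]ger0_norm ?addr_ge0 ?sqr_ge0//.
rewrite -(real_normK (num_real (u x))) -(real_normK (num_real (v x))).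
have := sqr_ge0 (`|u x| - `|v x|); have := sqr_ge0 `|u x|; have := sqr_ge0 `|v x|.
by rewrite sqrrB -mulr_natr; move: (_ * `|v x|) => w; lra.
Qed.

Lemma sq_integrableD u v : sq_integrable u -> sq_integrable v ->
  sq_integrable (fun x => u x + v x).
Proof.
move=> su sv; have [[mu_ iu] [mv iv]] := (su, sv).
split; first exact: measurable_funD.
rewrite (_ : _ \o _ = (fun x => (u x ^+ 2)%:E + (2%:E * (u x * v x)%:E + (v x ^+ 2)%:E))%E).
  apply: integrableD => //; apply: integrableD => //.
  exact: (integrableZl measurableT 2 (integrable_mul su sv)).
by apply/funext => x /=; rewrite -EFinM -!EFinD; congr _%:E; rewrite sqrrD -mulr_natl; lra.
Qed.

Lemma sq_integrableZ (c : R) u : sq_integrable u ->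
  sq_integrable (fun x => c * u x).
Proof.
move=> [mu_ iu]; split; first by apply: measurable_funM => //; exact: measurable_cst.
rewrite (_ : _ \o _ = (fun x => (c ^+ 2)%:E * (u x ^+ 2)%:E)%E).
  exact: integrableZl.
by apply/funext => x /=; rewrite -EFinM exprMn.
Qed.

Definition L2sq f : \bar R := (\int[mu]_x (normc2 (f x))%:E)%E.

Lemma L2norm_sq f : (L2norm mu f `^ 2 = L2sq f)%E.
Proof.
rewrite /L2norm poweR_Lnorm ?pnatr_eq0//; apply: eq_integral => x _.
have n0 : 0 <= Normc.normc (f x) by case: (f x) => a b; exact: sqrtr_ge0.
rewrite gee0_abs ?lee_fin// poweR_EFin powR_mulrn//; congr _%:E.
by rewrite /normc2; case: (f x) => a b /=; rewrite sqr_sqrtr// addr_ge0 ?sqr_ge0.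
Qed.

Lemma in_L2P f : in_L2 mu f <->
  sq_integrable (fun x => CRe (f x)) /\ sq_integrable (fun x => CIm (f x)).
Proof.
split=> [[[mr mi] foo]|[[mr ir] [mi ii]]].
  have sqoo : (L2sq f < +oo)%E by rewrite -L2norm_sq; exact: poweR_lty.
  have mnorm : measurable_fun setT (fun x => (normc2 (f x))%:E).
    apply/measurable_EFinP.
    by apply: measurable_funD; apply: measurable_funX.
  have inorm : mu.-integrable setT (fun x => (normc2 (f x))%:E).
    apply/integrableP; split => //.
    rewrite (eq_integral (fun x => (normc2 (f x))%:E)) => [|x _]; first exact: sqoo.
    by rewrite gee0_abs// lee_fin addr_ge0// sqr_ge0.
  split; split => //; apply: (le_integrable measurableT _ _ inorm).
  - by apply/measurable_EFinP; exact: measurable_funX.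
  - move=> x _ /=; rewrite lee_fin !ger0_norm ?addr_ge0 ?sqr_ge0//.
    by rewrite lerDl sqr_ge0.
  - by apply/measurable_EFinP; exact: measurable_funX.
  - move=> x _ /=; rewrite lee_fin !ger0_norm ?addr_ge0 ?sqr_ge0//.
    by rewrite lerDr sqr_ge0.
split; first by [].
apply: (@lty_poweRy _ _ 2); rewrite ?pnatr_eq0// L2norm_sq.
have /integrableP[_] := integrableD measurableT ir ii.
apply: le_lt_trans; rewrite le_eqVlt; apply/orP; left; apply/eqP.
by apply: eq_integral => x _ /=; rewrite ger0_norm// addr_ge0 ?sqr_ge0.
Qed.

Lemma in_L2D f g : in_L2 mu f -> in_L2 mu g -> in_L2 mu (fun x => f x + g x).
Proof.
move=> /in_L2P[fr fi] /in_L2P[gr gi]; apply/in_L2P; split.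
- rewrite (_ : (fun x => _) = fun x => CRe (f x) + CRe (g x)); first exact: sq_integrableD.
  by apply/funext => x; case: (f x); case: (g x).
- rewrite (_ : (fun x => _) = fun x => CIm (f x) + CIm (g x)); first exact: sq_integrableD.
  by apply/funext => x; case: (f x); case: (g x).
Qed.

Lemma in_L2Z (c : R[i]) f : in_L2 mu f -> in_L2 mu (fun x => c * f x).
Proof.
case: c => a b /in_L2P[fr fi]; apply/in_L2P; split.
- rewrite (_ : (fun x => _) = fun x => a * CRe (f x) + (- b) * CIm (f x)).
    by apply: sq_integrableD; exact: sq_integrableZ.
  by apply/funext => x; case: (f x) => r i /=; rewrite mulNr.
- rewrite (_ : (fun x => _) = fun x => a * CIm (f x) + b * CRe (f x)).
    by apply: sq_integrableD; exact: sq_integrableZ.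
  by apply/funext => x; case: (f x) => r i /=.
Qed.

Lemma in_L20 : in_L2 mu (fun=> 0).
Proof.
have s0 : sq_integrable (fun=> 0).
  split; first exact: measurable_cst.
  rewrite (_ : _ \o _ = cst 0%E); first exact: integrable0.
  by apply/funext => x /=; rewrite expr0n.
exact/in_L2P.
Qed.

Let J u v := \int[mu]_x (u x * v x).

Lemma L2innerE f g : in_L2 mu f -> in_L2 mu g -> L2inner mu f g =
  Complex (J (CRe \o f) (CRe \o g) + J (CIm \o f) (CIm \o g))
          (J (CIm \o f) (CRe \o g) - J (CRe \o f) (CIm \o g)).
Proof.
move=> /in_L2P[fr fi] /in_L2P[gr gi]; rewrite /L2inner /J; congr Complex.
- rewrite -RintegralD//; try exact: integrable_mul.
  apply: eq_Rintegral => x _ /=; case: (f x) => a b; case: (g x) => a' b' /=.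
  by rewrite mulrN opprK.
- rewrite -RintegralB//; try exact: integrable_mul.
  apply: eq_Rintegral => x _ /=; case: (f x) => a b; case: (g x) => a' b' /=.
  by rewrite mulrN addrC.
Qed.

Let JD u1 u2 v : sq_integrable u1 -> sq_integrable u2 -> sq_integrable v ->
  J (fun x => u1 x + u2 x) v = J u1 v + J u2 v.
Proof.
move=> s1 s2 sv; rewrite /J -RintegralD//; try exact: integrable_mul.
by apply: eq_Rintegral => x _; rewrite mulrDl.
Qed.

Let JZ (c : R) u v : sq_integrable u -> sq_integrable v ->
  J (fun x => c * u x) v = c * J u v.
Proof.
move=> su sv; rewrite /J -RintegralZl//; last exact: integrable_mul.
by apply: eq_Rintegral => x _; rewrite mulrA.
Qed.

Lemma L2inner_conj f g : in_L2 mu f -> in_L2 mu g ->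
  L2inner mu g f = (L2inner mu f g)^*%C.
Proof.
move=> fL gL; rewrite !L2innerE//=.
have JC u v : J u v = J v u by apply: eq_Rintegral => x _; rewrite mulrC.
by rewrite (JC (CRe \o g)) (JC (CIm \o g)) (JC (CIm \o g)) (JC (CRe \o g)) opprB.
Qed.

Lemma L2innerDl f g h : in_L2 mu f -> in_L2 mu g -> in_L2 mu h ->
  L2inner mu (fun x => f x + g x) h = L2inner mu f h + L2inner mu g h.
Proof.
move=> fL gL hL; rewrite !L2innerE//; last exact: in_L2D.
move/in_L2P : fL => [fr fi]; move/in_L2P : gL => [gr gi]; move/in_L2P : hL => [hr hi].
have -> : CRe \o (fun x => f x + g x) = fun x => CRe (f x) + CRe (g x).
  by apply/funext => x /=; case: (f x); case: (g x).
have -> : CIm \o (fun x => f x + g x) = fun x => CIm (f x) + CIm (g x).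
  by apply/funext => x /=; case: (f x); case: (g x).
rewrite !JD//; apply/eqP; rewrite eq_complex /= /comp; apply/andP; split; apply/eqP.
  by move: (J _ _) (J _ _) (J _ _) (J _ _) => *; lra.
by move: (J _ _) (J _ _) (J _ _) (J _ _) => *; lra.
Qed.

Lemma L2innerZl (c : R[i]) f h : in_L2 mu f -> in_L2 mu h ->
  L2inner mu (fun x => c * f x) h = c * L2inner mu f h.
Proof.
move=> fL hL; rewrite !L2innerE//; last exact: in_L2Z.
move/in_L2P : fL => [fr fi]; move/in_L2P : hL => [hr hi]; case: c => a b.
have -> : CRe \o (fun x => Complex a b * f x) = fun x => a * CRe (f x) + (- b) * CIm (f x).
  by apply/funext => x /=; case: (f x) => r i /=; rewrite mulNr.
have -> : CIm \o (fun x => Complex a b * f x) = fun x => a * CIm (f x) + b * CRe (f x).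
  by apply/funext => x /=; case: (f x) => r i /=.
rewrite !JD//; try exact: sq_integrableZ.
rewrite !JZ//; apply/eqP; rewrite eq_complex /= /comp; apply/andP; split; apply/eqP.
  by move: (J _ _) (J _ _) (J _ _) (J _ _) => *; lra.
by move: (J _ _) (J _ _) (J _ _) (J _ _) => *; lra.
Qed.

Definition L2normsq f : R := CRe (L2inner mu f f).

Lemma L2normsqE f : in_L2 mu f -> L2inner mu f f = (L2normsq f)%:C%C.
Proof.
move=> fL; rewrite /L2normsq; apply/eqP; rewrite eq_complex eqxx (L2innerE fL fL) /=.
have JC u v : J u v = J v u by apply: eq_Rintegral => x _; rewrite mulrC.
by rewrite (JC (CIm \o f)) subrr.
Qed.

Lemma L2normsq_ge0 f : in_L2 mu f -> 0 <= L2normsq f.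
Proof.
move=> fL; rewrite /L2normsq L2innerE//= addr_ge0// /J;
by apply: Rintegral_ge0 => x _; rewrite -expr2 sqr_ge0.
Qed.

Lemma L2sqE f : in_L2 mu f -> L2sq f = (L2normsq f)%:E.
Proof.
move=> fL; rewrite /L2normsq L2innerE//=; have [[mr ir] [mi ii]] := iffLR (in_L2P f) fL.
have fr := integrable_fin_num measurableT ir.
have fi := integrable_fin_num measurableT ii.
rewrite /J /Rintegral EFinD !fineK//.
exact: (integralD measurableT ir ii).
Qed.

Lemma L2norm_lt f (e : R) : in_L2 mu f -> 0 < e ->
  (L2norm mu f < e%:E)%E -> L2normsq f < e ^+ 2.
Proof.
move=> fL e0 fe; have n0 : (0 <= L2norm mu f)%E by exact: Lnorm_ge0.
have nfin : L2norm mu f \is a fin_num by rewrite ge0_fin_numE// (lt_trans fe) ?ltry.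
have := L2norm_sq f; rewrite L2sqE// -(fineK nfin) poweR_EFin powR_mulrn ?fine_ge0//.
move=> [] <-; rewrite ltrXn2r ?fine_ge0//.
by rewrite -lte_fin fineK.
Qed.

Lemma L2normsqD f g : in_L2 mu f -> in_L2 mu g -> L2inner mu f g = 0 ->
  L2normsq (fun x => f x + g x) = L2normsq f + L2normsq g.
Proof.
move=> fL gL fg; have sL := in_L2D fL gL.
have gf : L2inner mu g f = 0 by rewrite (L2inner_conj fL gL) fg conjc0.
rewrite /L2normsq L2innerDl// (L2inner_conj sL fL) (L2inner_conj sL gL) !L2innerDl//.
by rewrite fg gf addr0 add0r !L2normsqE//= !conjc_real.
Qed.

Lemma L2inner_suml (I : eqType) (s : seq I) (c : I -> R[i]) (F : I -> X -> R[i]) h :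
  (forall i, i \in s -> in_L2 mu (F i)) -> in_L2 mu h ->
  in_L2 mu (fun x => \sum_(i <- s) c i * F i x) /\
  L2inner mu (fun x => \sum_(i <- s) c i * F i x) h =
  \sum_(i <- s) c i * L2inner mu (F i) h.
Proof.
move=> FL hL; elim: s FL => [|i s IH] FL.
  under eq_fun do rewrite big_nil; split; first exact: in_L20.
  rewrite big_nil L2innerE//; last exact: in_L20.
  have J0 u : J (fun=> 0) u = 0.
    rewrite /J; under eq_Rintegral do rewrite mul0r.
    by rewrite Rintegral_cst// mul0r.
  rewrite (_ : CRe \o _ = fun=> 0)// (_ : CIm \o _ = fun=> 0)//.
  by rewrite !J0 addr0 subr0.
have [sL sE] : _ /\ _ := IH (fun j js => FL j (mem_behead (s := i :: s) js)).
have FiL : in_L2 mu (F i) by apply: FL; exact: mem_head.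
under eq_fun do rewrite big_cons; split.
  by apply: in_L2D => //; exact: in_L2Z.
rewrite L2innerDl//; last exact: in_L2Z.
by rewrite L2innerZl// sE big_cons.
Qed.

Section Parseval.
Context (I : choiceType) (S : set I) (e : I -> X -> R[i]).
Hypothesis basis : L2_orthonormal_basis mu S e.

Let projection f (s : seq I) x := \sum_(i <- s) L2inner mu f (e i) * e i x.

(** The remainder is orthogonal to the span of the chosen vectors, so Pythagoras gives both the norm
    formula and the best approximation property. The list [s'] may have repetitions, as do the lists
    supplied by density. *)
Lemma L2_projection f (s : seq I) : in_L2 mu f -> uniq s ->
  (forall i, i \in s -> S i) ->
  exists r, [/\ in_L2 mu r,
    L2normsq f = L2normsq r + \sum_(i <- s) normc2 (L2inner mu f (e i)) &
    forall (s' : seq I) c, {subset s' <= s} ->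
      L2normsq r <= L2normsq (fun x => f x - \sum_(i <- s') c i * e i x)].
Proof.
have [eL eO _] := basis; move=> fL us sS.
have esL i : i \in s -> in_L2 mu (e i) by move=> /sS; exact: eL.
have pL : in_L2 mu (projection f s).
  by have [] := L2inner_suml (fun i => L2inner mu f (e i)) esL fL.
pose r x := f x + (-1) * projection f s x.
have rL : in_L2 mu r by apply: in_L2D => //; exact: in_L2Z.
have re j : j \in s -> L2inner mu r (e j) = 0.
  move=> js; rewrite /r L2innerDl//; [|exact: in_L2Z|exact: esL].
  rewrite L2innerZl//; last exact: esL.
  have [_ ->] := L2inner_suml (fun i => L2inner mu f (e i)) esL (esL j js).
  rewrite (bigD1_seq j)//= (eO j j)//; [|exact: sS|exact: sS].
  rewrite eqxx mulr1 big_seq_cond big1 ?addr0 ?mulN1r ?subrr// => i /andP[is_ ij].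
  by rewrite (eO i j) ?(negbTE ij) ?mulr0//; exact: sS.
have rh (s' : seq I) c : {subset s' <= s} ->
    L2inner mu r (fun x => \sum_(i <- s') c i * e i x) = 0.
  move=> s's; have es'L i : i \in s' -> in_L2 mu (e i) by move=> /s's/esL.
  have [hL hE] := L2inner_suml c es'L rL.
  rewrite (L2inner_conj hL rL) hE big_seq big1 ?conjc0// => i is'.
  by rewrite (L2inner_conj rL (es'L i is')) re ?conjc0 ?mulr0//; exact: s's.
exists r; split => //.
  have -> : L2normsq f = L2normsq (fun x => r x + projection f s x).
    by congr L2normsq; apply/funext => x; rewrite /r mulN1r subrK.
  rewrite L2normsqD//; last exact: rh.
  congr (_ + _); rewrite /L2normsq.
  have [_ hE] := L2inner_suml (fun i => L2inner mu f (e i)) esL pL.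
  rewrite hE raddf_sum; apply: eq_big_seq => i is_.
  have pe : L2inner mu (projection f s) (e i) = L2inner mu f (e i).
    apply/esym/eqP; rewrite -subr_eq0 -(re i is_) /r L2innerDl//; last 2 first.
    - exact: in_L2Z.
    - exact: esL.
    by rewrite L2innerZl ?mulN1r//; exact: esL.
  rewrite (L2inner_conj pL (esL i is_)) pe /normc2.
  by case: (L2inner mu f (e i)) => a b /=; rewrite mulrN opprK.
move=> s' c s's; have es'L i : i \in s' -> in_L2 mu (e i) by move=> /s's/esL.
have [hL hE] := L2inner_suml c es'L rL.
set h := (fun x => _) in hL hE.
pose q x := projection f s x + (-1) * h x.
have qL : in_L2 mu q by apply: in_L2D => //; exact: in_L2Z.
have rq : L2inner mu r q = 0.
  rewrite (L2inner_conj qL rL) /q L2innerDl//; last exact: in_L2Z.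
  rewrite L2innerZl// (L2inner_conj rL pL) (L2inner_conj rL hL).
  by rewrite rh// rh// !conjc0 mulr0 addr0 conjc0.
have -> : (fun x => f x - h x) = (fun x => r x + q x).
  by apply/funext => x; rewrite /r /q !mulN1r addrA subrK.
by rewrite L2normsqD// lerDl L2normsq_ge0.
Qed.

(** One inequality is Bessel's. For the other, an approximation within the square root of [eps]
    bounds the squared remainder of the projection by [eps]. *)
Lemma parseval f : in_L2 mu f ->
  (\esum_(i in S) (normc2 (L2inner mu f (e i)))%:E = (L2normsq f)%:E)%E.
Proof.
have [eL eO eD] := basis; move=> fL; apply/eqP; rewrite eq_le; apply/andP; split.
  apply: ge_ereal_sup => _ [A [finA AS] <-].
  rewrite fsbig_finite//= sumEFin lee_fin.
  have [||r [rL -> _]] := L2_projection (s := finmap.enum_fset (fset_set A)) fL.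
  - exact: finmap.fset_uniq.
  - by move=> i; rewrite in_fset_set// inE => /AS.
  by rewrite lerDr L2normsq_ge0.
apply/lee_addgt0Pr => eps eps0.
have sq0 : 0 < Num.sqrt eps by rewrite sqrtr_gt0.
have [s [c [sS sc]]] := eD f fL (Num.sqrt eps) sq0.
have [||r [rL fE rmin]] := L2_projection (s := undup s) fL.
- exact: undup_uniq.
- by move=> i; rewrite mem_undup; exact: sS.
have sL i : i \in s -> in_L2 mu (e i) by move=> /sS; exact: eL.
have [hL _] := L2inner_suml c sL fL.
have dL : in_L2 mu (fun x => f x - \sum_(i <- s) c i * e i x).
  rewrite (_ : (fun x => _) = fun x => f x + (-1) * \sum_(i <- s) c i * e i x).
    by apply: in_L2D => //; exact: in_L2Z.
  by apply/funext => x; rewrite mulN1r.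
have /ltW := le_lt_trans (rmin s c (fun i => etrans (mem_undup s i)))
  (L2norm_lt dL sq0 sc).
rewrite sqr_sqrtr; last exact: ltW.
move=> reps; rewrite fE EFinD addeC leeD// ?lee_fin//.
apply: esum_ge; exists [set` undup s].
  by split; [exact: finite_seq|move=> i /=; rewrite mem_undup; exact: sS].
rewrite -fsbig_seq; last exact: undup_uniq.
by rewrite sumEFin.
Qed.

End Parseval.

End L2Space.

(** * Gabor bases *)

Section NullIntegral.
Context d (X : measurableType d) (R : realType) (mu : {measure set X -> \bar R}).
Implicit Types (F G : X -> R).

(** Integrability is bundled with the vanishing of the integral, so that linear combinations carry
    no side conditions. *)
Definition null_integral F :=
  mu.-integrable setT (EFin \o F) /\ \int[mu]_x F x = 0.

Lemma null_integralD F G : null_integral F -> null_integral G ->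
  null_integral (fun x => F x + G x).
Proof.
move=> [iF F0] [iG G0]; split; last by rewrite RintegralD// F0 G0 addr0.
exact: (integrableD measurableT iF iG).
Qed.

Lemma null_integralZ (c : R) F : null_integral F ->
  null_integral (fun x => c * F x).
Proof.
move=> [iF F0]; split; last by rewrite RintegralZl// F0 mulr0.
exact: (integrableZl measurableT c iF).
Qed.

Lemma null_integralB F G : null_integral F -> null_integral G ->
  null_integral (fun x => F x - G x).
Proof.
move=> F0 G0; rewrite (_ : (fun x => _) = fun x => F x + (-1) * G x).
  by apply: null_integralD F0 _; exact: null_integralZ.
by apply/funext => x; rewrite mulN1r.
Qed.

Lemma eq_null_integral F G : F =1 G -> null_integral F -> null_integral G.
Proof. by move=> /funext ->. Qed.

(** The function r exp(i th), with [r] real of any sign. Inner products of such functions become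
    real integrals of cosines and sines of angle differences. *)
Definition polar (r th : X -> R) (x : X) : R[i] :=
  Complex (r x * cos (th x)) (r x * sin (th x)).

Lemma L2inner_polar r a s b : L2inner mu (polar r a) (polar s b) =
  Complex (\int[mu]_x (r x * s x * cos (a x - b x)))
          (\int[mu]_x (r x * s x * sin (a x - b x))).
Proof.
rewrite /L2inner; congr Complex; apply: eq_Rintegral => x _ /=.
  by rewrite cosB; lra.
by rewrite sinB; lra.
Qed.

End NullIntegral.

Lemma bounded_mfun_cos d (X : measurableType d) (R : realType) (h : X -> R) :
  measurable_fun setT h -> bounded_mfun (fun x => cos (h x)).
Proof.
move=> mh; split.
  by apply: measurableT_comp mh; exact: continuous_measurable_fun (@continuous_cos R).
by exists 1 => x; rewrite ler_norml cos_geN1 cos_le1.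
Qed.

Lemma bounded_mfun_sin d (X : measurableType d) (R : realType) (h : X -> R) :
  measurable_fun setT h -> bounded_mfun (fun x => sin (h x)).
Proof.
move=> mh; split.
  by apply: measurableT_comp mh; exact: continuous_measurable_fun (@continuous_sin R).
by exists 1 => x; rewrite ler_norml sin_geN1 sin_le1.
Qed.

Lemma in_L2_polar d (X : measurableType d) (R : realType)
    (mu : {measure set X -> \bar R}) (D : set X) (phi th : X -> R) :
  mu.-integrable setT (EFin \o \1_D) -> bounded_mfun phi ->
  measurable_fun setT th -> in_L2 mu (polar (fun x => \1_D x * phi x) th).
Proof.
move=> iD bphi mth.
have mD : measurable_fun setT (\1_D : X -> R).
  by apply/measurable_EFinP; exact: measurable_int iD.
have sq (psi : X -> R) : bounded_mfun psi ->
    sq_integrable mu (fun x => \1_D x * phi x * psi x).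
  move=> bpsi; have bm := bounded_mfunM bphi bpsi; split.
    have [mb _] := bm.
    rewrite (_ : (fun x => _) = \1_D \* (fun x => phi x * psi x)); last first.
      by apply/funext => x /=; rewrite mulrA.
    exact: measurable_funM mD mb.
  rewrite (_ : _ \o _ = EFin \o (fun x => \1_D x * (phi x * psi x * (phi x * psi x)))).
    exact: (integrable_bounded_mfun iD (bounded_mfunM bm bm)).
  apply/funext => x /=; congr _%:E; rewrite indicE.
  by case: (_ \in _); rewrite ?mul1r ?mul0r ?expr0n.
apply/in_L2P; split; apply: sq.
- exact: bounded_mfun_cos.
- exact: bounded_mfun_sin.
Qed.

(** * The two tilings obtained from the Gabor basis *)

Section GaborTiling.
Context (R : realType) (d : nat) (K : set 'cV[R]_d) (A B C : 'M[R]_d).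
Local Notation X := 'cV[R]_d.
Local Notation Z := 'cV[int]_d.
Local Notation leb := (@lebesgue R d).
Local Notation M := (block_mx A 0 C B).
Local Notation T := ((invmx B)^T).
Hypotheses (mK : measurable K) (K0 : (0 < lebesgue K)%E)
  (Koo : (lebesgue K < +oo)%E).
Hypotheses (uB : B \in unitmx) (uM : M \in unitmx).
Hypothesis basis :
  gabor_orthonormal_basis (normalized_indicator K) (lattice M).

Let uT : T \in unitmx. Proof. by rewrite unitmx_tr unitmx_inv. Qed.

Let kappa : R := fine (lebesgue K) `^ (- 2^-1).
Let gab (m n : Z) : X -> R[i] :=
  time_freq_shift (lattice_pt M (col_mx m n)) (normalized_indicator K).
(** The phase contributed by C: the part of the modulation in block [m] that need not be
    periodic. *)
Let shear (m : Z) (x : X) : R := 2 * pi * dotv (C *m map_mx intr m) x.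
Let KA (m : Z) : set X := [set x | K (x + - lattice_pt A m)].

Let kappa_gt0 : 0 < kappa.
Proof. by rewrite powR_gt0// fine_gt0// K0. Qed.

Let mKA m : measurable (KA m).
Proof. by rewrite -[X in measurable X]setTI; exact: measurable_shift. Qed.

Let KA_fin m : (lebesgue (KA m) < +oo)%E.
Proof. by rewrite lebesgue_shift. Qed.

Let phaseE n x : 2 * pi * dotv (B *m map_mx intr n) x = phase T n x.
Proof.
rewrite /phase /dotv; congr (_ * _).
transitivity (\sum_i \sum_j B i j * (n j 0)%:~R * x i 0).
  apply: eq_bigr => i _; rewrite mxE mulr_suml; apply: eq_bigr => j _.
  by rewrite mxE.
rewrite exchange_big; apply: eq_bigr => j _ /=.
rewrite /lattice_coord -trmx_inv invmxK mxE mulr_sumr; apply: eq_bigr => i _.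
by rewrite mxE mulrAC mulrC mulrA.
Qed.

Let gabE m n :
  gab m n = polar (fun x => kappa * \1_(KA m) x) (fun x => shear m x + phase T n x).
Proof.
apply/funext => x; rewrite /gab /time_freq_shift /lattice_pt map_col_mx.
rewrite mul_block_col mul0mx addr0 col_mxKu col_mxKd.
have -> : 2 * pi * dotv (C *m map_mx intr m + B *m map_mx intr n) x =
    shear m x + phase T n x.
  rewrite -phaseE /shear -mulrDr; congr (_ * _).
  by rewrite /dotv -big_split; apply: eq_bigr => i _; rewrite mxE mulrDl.
rewrite /normalized_indicator -/kappa /polar /cis.
have -> : \1_K (x - A *m map_mx intr m) = \1_(KA m) x :> R by [].
by apply/eqP; rewrite eq_complex /= !mulr0 subr0 add0r ![_ * (kappa * _)]mulrC !eqxx.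
Qed.

Let measurable_shear m : measurable_fun setT (shear m).
Proof.
apply: measurable_funM; first exact: measurable_cst.
apply: measurable_sum => i; apply: measurable_funM; first exact: measurable_cst.
exact: measurable_coord.
Qed.

Let measurable_phase n : measurable_fun setT (phase T n).
Proof.
rewrite (_ : phase T n = fun x => 2 * pi * dotv (B *m map_mx intr n) x).
  apply: measurable_funM; first exact: measurable_cst.
  apply: measurable_sum => i; apply: measurable_funM; first exact: measurable_cst.
  exact: measurable_coord.
by apply/funext => x; rewrite phaseE.
Qed.

Let iKA m : leb.-integrable setT (EFin \o \1_(KA m)).
Proof. exact: (integrable_indic_lebesgue (mKA m) (KA_fin m)). Qed.

(** Inner product of the basis elements (m, n) and (m', 0), divided by kappa^2 and split into real
    and imaginary parts. *)
Let gab_orth m m' n : (m != m') || (n != 0) ->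
  null_integral leb (fun x => \1_(KA m) x * \1_(KA m') x *
    cos (shear m x - shear m' x + phase T n x)) /\
  null_integral leb (fun x => \1_(KA m) x * \1_(KA m') x *
    sin (shear m x - shear m' x + phase T n x)).
Proof.
move=> mn; have [_ eO _] := basis.
have L1 : lattice M (lattice_pt M (col_mx m n)) by exists (col_mx m n).
have L2 : lattice M (lattice_pt M (col_mx m' 0)) by exists (col_mx m' 0).
have neq : (lattice_pt M (col_mx m n) == lattice_pt M (col_mx m' 0)) = false.
  apply/negbTE/eqP => /(lattice_pt_inj uM) /eq_col_mx[mm' n0].
  by move: mn; rewrite mm' n0 !eqxx.
have := eO _ _ L1 L2; rewrite neq -/(gab m n) -/(gab m' 0) !gabE L2inner_polar.
move=> [int_cos int_sin].
have mth : measurable_fun setT (fun x => shear m x - shear m' x + phase T n x).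
  apply: measurable_funD (measurable_phase n).
  exact: (measurable_funB (measurable_shear m) (measurable_shear m')).
have int0 (f : X -> R) : bounded_mfun f -> \int[leb]_x
     (kappa * \1_(KA m) x * (kappa * \1_(KA m') x) * f x) = 0 ->
   null_integral leb (fun x => \1_(KA m) x * \1_(KA m') x * f x).
  move=> bf f0.
  have i11 : leb.-integrable setT (EFin \o (fun x => \1_(KA m) x * \1_(KA m') x * f x)).
    rewrite (_ : (fun x => _) = fun x => \1_(KA m) x * (\1_(KA m') x * f x)).
      exact: (integrable_bounded_mfun (iKA m) (bounded_mfunM (bounded_mfun_indic R (mKA m')) bf)).
    by apply/funext => x; rewrite mulrA.
  split => //.
  have : kappa * kappa * \int[leb]_x (\1_(KA m) x * \1_(KA m') x * f x) = 0.
    rewrite -RintegralZl// -[RHS]f0; apply: eq_Rintegral => x _.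
    by rewrite [kappa * _ * (kappa * _)]mulrACA !mulrA.
  by move/eqP; rewrite !mulf_eq0 gt_eqF//= => /eqP.
have thE x : shear m x + phase T n x - (shear m' x + phase T 0 x) =
    shear m x - shear m' x + phase T n x by rewrite phase0; lra.
split; apply: int0.
- exact: bounded_mfun_cos.
- by rewrite -[RHS]int_cos; apply: eq_Rintegral => x _; rewrite thE.
- exact: bounded_mfun_sin.
- by rewrite -[RHS]int_sin; apply: eq_Rintegral => x _; rewrite thE.
Qed.

(* orthogonality within one block m = m' = 0 says that the exponentials of the
   lattice B Z^d are orthogonal in L^2(K) *)
Lemma gabor_level : exists N : nat,
  (0 < N)%N /\ {ae leb, forall x, lattice_count T K x = (N%:R)%:E}.
Proof.
have Kn b n : n != 0 -> \int[leb]_x (\1_K x * trig T b n x) = 0.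
  move=> n0; have [|[_ c0] [_ s0]] := @gab_orth 0 0 n; first by rewrite n0 orbT.
  have KE x : \1_(KA 0) x * \1_(KA 0) x = \1_K x :> R.
    rewrite !indicE -natrM mulnb andbb; congr ((nat_of_bool _)%:R).
    by apply/idP/idP; rewrite !inE /KA /= lattice_pt0 subr0.
  case: b.
    by rewrite -[RHS]c0; apply: eq_Rintegral => x _; rewrite KE subrr add0r.
  by rewrite -[RHS]s0; apply: eq_Rintegral => x _; rewrite KE subrr add0r.
have cK := lattice_count_const uT mK Koo K0 Kn.
set r := _ / _ in cK.
(* Otherwise the null exceptional set would contain [K]. A single point where the count is r makes r
   a natural number. *)
have [x xr] : exists x, lattice_count T K x = r%:E.
  apply: contrapT => /forallNP nx; move: K0; rewrite lt0e => /andP[/eqP K0' _]; apply: K0'.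
  have [N [mN N0 NS]] := cK.
  by apply: lebesgue_null_sub N0 => x _; apply: NS => /=; exact: nx.
have [N rN] := lattice_count_natural xr.
exists N; split; last by rewrite -rN.
rewrite -(ltr_nat R) -rN divr_gt0// fine_gt0//.
  by rewrite K0.
by rewrite (lattice_cell_pos uT K0) lattice_cell_fin.
Qed.

Context (N : nat).
Hypothesis N_gt0 : (0 < N)%N.
Hypothesis levelN : {ae leb, forall x, lattice_count T K x = (N%:R)%:E}.

Let N0 : N%:R != 0 :> R. Proof. by rewrite pnatr_eq0 -lt0n. Qed.

Let KA_level m : {ae leb, forall x, lattice_count T (KA m) x = (N%:R)%:E}.
Proof.
have [E [mE E0 ES]] := levelN.
exists ((fun x => x + - lattice_pt A m) @^-1` E); split.
- by rewrite -[X in measurable X]setTI; exact: measurable_shift.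
- by rewrite lebesgue_shift.
move=> x /= nx; apply: ES => /= cx; apply: nx; rewrite -cx.
apply: eq_esum => z _; rewrite !indicE; congr ((nat_of_bool _)%:R%:E).
by apply/idP/idP; rewrite !inE /KA /= addrAC.
Qed.

(** * Energy of one block for a set inside a translated cell *)

Section Block.
Context (z0 : Z) (S : set X).
Hypothesis mS : measurable S.
Hypothesis S_cell : forall x, S x -> lattice_cell T (x - lattice_pt T z0).

(** The point of the coset of [x] in the translate of the cell by [z0]; on [S] it is the
    identity. *)
Let rho (x : X) : X := lattice_frac T x + lattice_pt T z0.
Let Q m := S `&` KA m.
Let ff : X -> R[i] := polar (fun x => \1_S x * 1) (fun=> 0).
(* the projection of [ff] onto the closed span of the block [gab m] *)
Let vv m : X -> R[i] := polar (fun x => \1_(KA m) x * (N%:R^-1 * \1_(Q m) (rho x)))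
  (fun x => shear m x - shear m (rho x)).

Let mQ m : measurable (Q m). Proof. exact: measurableI. Qed.

Let trig_rho b n x : trig T b n (rho x) = trig T b n x.
Proof.
by rewrite /rho (trig_pt uT) /lattice_frac -lattice_ptN (trig_pt uT).
Qed.

Let cis_rho (a : R) n x : cos (a + phase T n (rho x)) = cos (a + phase T n x) /\
  sin (a + phase T n (rho x)) = sin (a + phase T n x).
Proof.
have c := trig_rho true n x; have s := trig_rho false n x.
by rewrite /trig in c s; rewrite !cosD !sinD c s.
Qed.

Let measurable_rho : measurable_fun setT (rho : X -> X).
Proof.
exact: (measurableT_comp (measurable_shift _) (measurable_lattice_frac T)).
Qed.

Let bounded_rho (F : X -> R) : bounded_mfun F -> bounded_mfun (fun x => F (rho x)).
Proof.
by move=> [mF [c Fc]]; split; [exact: measurableT_comp mF measurable_rho|exists c].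
Qed.

Let Rint_rho m (F : X -> R) : bounded_mfun F -> (forall x, F x != 0 -> S x) ->
  \int[leb]_x (\1_(KA m) x * F (rho x)) = N%:R * \int[leb]_x F x.
Proof.
move=> bF FS; apply: (Rintegral_frac uT (mKA m) (KA_fin m) _ (KA_level m) bF).
  by rewrite ler0n.
by move=> x /FS/S_cell.
Qed.

Let S_fin : (lebesgue S < +oo)%E.
Proof.
apply: (@le_lt_trans _ _ (lebesgue ((fun x : X => x + - lattice_pt T z0) @^-1` lattice_cell T))).
  exact: lebesgue_le.
by rewrite lebesgue_shift; exact: lattice_cell_fin.
Qed.

Let iS : leb.-integrable setT (EFin \o \1_S).
Proof. exact: integrable_indic_lebesgue mS S_fin. Qed.

Let ffL : in_L2 leb ff.
Proof.
exact: (in_L2_polar iS (bounded_mfun_cst _ 1) (measurable_cst (0 : R))).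
Qed.

Let vvL m : in_L2 leb (vv m).
Proof.
apply: (in_L2_polar (iKA m)).
  apply: bounded_mfunM; first exact: bounded_mfun_cst.
  exact: (bounded_rho (bounded_mfun_indic R (mQ m))).
apply: (measurable_funB (measurable_shear m)).
exact: (measurableT_comp (measurable_shear m) measurable_rho).
Qed.

(** Up to a constant factor, the integrand for [vv m] is the periodic extension of the integrand for
    [ff], cut off to [KA m]: replacing [x] by [rho x] does not affect the modulation by n. The N
    points of each coset in [KA m] cancel the factor 1/N. *)
Let inner_ff m n : L2inner leb ff (gab m n) = L2inner leb (vv m) (gab m n).
Proof.
have main (tr : R -> R) : bounded_mfun (fun x => tr (0 - (shear m x + phase T n x))) ->
    (forall x, tr (shear m x - shear m (rho x) - (shear m x + phase T n x)) =
      tr (0 - (shear m (rho x) + phase T n (rho x)))) ->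
    \int[leb]_x (\1_S x * 1 * (kappa * \1_(KA m) x) *
      tr (0 - (shear m x + phase T n x))) =
    \int[leb]_x (\1_(KA m) x * (N%:R^-1 * \1_(Q m) (rho x)) * (kappa * \1_(KA m) x) *
      tr (shear m x - shear m (rho x) - (shear m x + phase T n x))).
  move=> btr trE.
  pose G x := kappa * (\1_(Q m) x * tr (0 - (shear m x + phase T n x))).
  have bG : bounded_mfun G.
    apply: bounded_mfunM; first exact: bounded_mfun_cst.
    exact: (bounded_mfunM (bounded_mfun_indic R (mQ m)) btr).
  have GS x : G x != 0 -> S x.
    rewrite /G indicE; have [|_] := boolP (x \in Q m).
      by rewrite inE => -[].
    by rewrite mul0r mulr0 eqxx.
  transitivity (\int[leb]_x G x).
    apply: eq_Rintegral => x _; rewrite /G indicI mulr1 !mulrA.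
    by rewrite [\1_S x * kappa]mulrC.
  rewrite -[LHS](mulKf N0) -(Rint_rho m bG GS) -RintegralZl//; last first.
    exact: (integrable_bounded_mfun (iKA m) (bounded_rho bG)).
  apply: eq_Rintegral => x _; rewrite /G trE; set t := tr _.
  have e : \1_(KA m) x * \1_(KA m) x = \1_(KA m) x :> R.
    by rewrite indicE -natrM mulnb andbb.
  by rewrite -[in LHS]e; lra.
have mth : measurable_fun setT (fun x => 0 - (shear m x + phase T n x)).
  apply: measurable_funB; first exact: measurable_cst.
  exact: (measurable_funD (measurable_shear m) (measurable_phase n)).
have thE x : shear m x - shear m (rho x) - (shear m x + phase T n x) =
    - (shear m (rho x) + phase T n x) by lra.
rewrite gabE !L2inner_polar; congr Complex; apply: main.
- exact: bounded_mfun_cos.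
- move=> x; have [c _] := cis_rho (shear m (rho x)) n x.
  by rewrite thE sub0r !cosN c.
- exact: bounded_mfun_sin.
- move=> x; have [_ s] := cis_rho (shear m (rho x)) n x.
  by rewrite thE sub0r !sinN s.
Qed.

(** Adding and subtracting the relations for n and - n separates the shear difference from the
    phase. *)
Let shear_orth m m' b b' n : m != m' -> null_integral leb (fun x =>
  \1_(KA m) x * \1_(KA m') x *
   (if b then cos (shear m x - shear m' x) else sin (shear m x - shear m' x)) *
   trig T b' n x).
Proof.
move=> mm'; have [|cp sp] := @gab_orth m m' n; first by rewrite mm'.
have [|cm sm] := @gab_orth m m' (- n); first by rewrite mm'.
rewrite /trig; case: b; case: b'.
- apply: eq_null_integral (null_integralZ 2^-1 (null_integralD cp cm)) => x /=.
  by rewrite phaseN; move: (shear m x - _) => e; rewrite !cosD cosN sinN; lra.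
- apply: eq_null_integral (null_integralZ 2^-1 (null_integralB sp sm)) => x /=.
  by rewrite phaseN; move: (shear m x - _) => e; rewrite !sinD cosN sinN; lra.
- apply: eq_null_integral (null_integralZ 2^-1 (null_integralD sp sm)) => x /=.
  by rewrite phaseN; move: (shear m x - _) => e; rewrite !sinD cosN sinN; lra.
- apply: eq_null_integral (null_integralZ 2^-1 (null_integralB cm cp)) => x /=.
  by rewrite phaseN; move: (shear m x - _) => e; rewrite !cosD cosN sinN; lra.
Qed.

(** The real weights [w b], carried by the overlap of two blocks, are orthogonal to all
    trigonometric functions, hence to these times a periodic function. The rest of the integrand is
    of that form, because [vv m] depends on the cell only through [rho]. *)
Let vv_orth m m' n : m != m' -> L2inner leb (vv m) (gab m' n) = 0.
Proof.
move=> mm'.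
pose w b x := \1_(KA m) x * \1_(KA m') x *
  (if b then cos (shear m x - shear m' x) else sin (shear m x - shear m' x)).
pose psi b x := \1_(Q m) x * (if b then cos (shear m x) else sin (shear m x)).
have bpsi b : bounded_mfun (psi b).
  apply: (bounded_mfunM (bounded_mfun_indic R (mQ m))).
  by case: b; [apply: bounded_mfun_cos|apply: bounded_mfun_sin].
have bw b : bounded_mfun (fun x => \1_(KA m') x *
    (if b then cos (shear m x - shear m' x) else sin (shear m x - shear m' x))).
  have md := measurable_funB (measurable_shear m) (measurable_shear m').
  apply: (bounded_mfunM (bounded_mfun_indic R (mKA m'))).
  by case: b; [exact: bounded_mfun_cos|exact: bounded_mfun_sin].
have iw b : leb.-integrable setT (EFin \o w b).
  rewrite (_ : w b = fun x => \1_(KA m) x * (\1_(KA m') x *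
    (if b then cos (shear m x - shear m' x) else sin (shear m x - shear m' x)))).
    exact: (integrable_bounded_mfun (iKA m) (bw b)).
  by apply/funext => x; rewrite mulrA.
have w_orth b b' n' : \int[leb]_x (w b x * trig T b' n' x) = 0.
  by have [_] := shear_orth b b' n' mm'.
have null b1 b2 b3 : null_integral leb (fun x => w b1 x * (psi b2 (rho x) * trig T b3 n x)).
  (* [rho] is [lattice_frac] followed by a translation, which is absorbed into the function so that
     [trig_orth_periodic] applies. *)
  have bpsi' : bounded_mfun (fun x : X => psi b2 (x + lattice_pt T z0)).
    have [mpsi [c psic]] := bpsi b2.
    by split; [exact: (measurableT_comp mpsi (measurable_shift _))|exists c].
  have [_ /(_ b3 n) o] := trig_orth_periodic uT (iw b1) (w_orth b1) bpsi'.
  split; last exact: o.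
  apply: (integrable_bounded_mfun (iw b1)).
  exact: (bounded_mfunM (bounded_rho (bpsi b2)) (bounded_mfun_trig T b3 n)).
rewrite gabE L2inner_polar.
have thE x : shear m x - shear m (rho x) - (shear m' x + phase T n x) =
  (shear m x - shear m' x) - shear m (rho x) - phase T n x by lra.
pose c0 := N%:R^-1 * kappa.
have Ic : null_integral leb (fun x =>
    \1_(KA m) x * (N%:R^-1 * \1_(Q m) (rho x)) * (kappa * \1_(KA m') x) *
    cos (shear m x - shear m (rho x) - (shear m' x + phase T n x))).
  (* The four terms come from the addition formulas for the shear difference, the shear at [rho x]
     and the phase. *)
  apply: (eq_null_integral _ (null_integralZ c0 (null_integralB
    (null_integralD (null_integralD (null true true true) (null false false true))
      (null false true false)) (null true false false)))) => x.
  rewrite thE /w /psi /trig /c0; move: (shear m x - shear m' x) => e.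
  by rewrite (cosB (e - _)) cosB sinB; lra.
have Is : null_integral leb (fun x =>
    \1_(KA m) x * (N%:R^-1 * \1_(Q m) (rho x)) * (kappa * \1_(KA m') x) *
    sin (shear m x - shear m (rho x) - (shear m' x + phase T n x))).
  apply: (eq_null_integral _ (null_integralZ c0 (null_integralB
    (null_integralB (null_integralB (null false true true) (null true false true))
      (null true true false)) (null false false false)))) => x.
  rewrite thE /w /psi /trig /c0; move: (shear m x - shear m' x) => e.
  by rewrite (sinB (e - _)) cosB sinB; lra.
by have [_ ->] := Ic; have [_ ->] := Is.
Qed.

Let normsq_ff : L2normsq leb ff = fine (lebesgue S).
Proof.
rewrite /L2normsq /ff L2inner_polar /= -(Rintegral_indic_lebesgue mS).
apply: eq_Rintegral => x _; rewrite subrr cos0 !mulr1 indicE -natrM mulnb andbb//.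
Qed.

Let normsq_vv m : L2normsq leb (vv m) = fine (lebesgue (Q m)) / N%:R.
Proof.
rewrite /L2normsq /vv L2inner_polar /= -(Rintegral_indic_lebesgue (mQ m)).
have bQ := bounded_mfun_indic R (mQ m).
have QS x : \1_(Q m) x != 0 :> R -> S x.
  by rewrite indicE; have [|_] := boolP (x \in Q m); [rewrite inE => -[]|rewrite eqxx].
transitivity (\int[leb]_x (N%:R^-1 * N%:R^-1 * (\1_(KA m) x * \1_(Q m) (rho x)))).
  apply: eq_Rintegral => x _; rewrite subrr cos0 mulr1 !indicE.
  by case: (x \in KA m); case: (rho x \in Q m) => /=; rewrite ?(mulr1, mul1r, mulr0, mul0r).
rewrite RintegralZl//; last exact: (integrable_bounded_mfun (iKA m) (bounded_rho bQ)).
by rewrite (Rint_rho m bQ QS) -mulrA mulKf// mulrC.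
Qed.

Let parseval_gab (h : X -> R[i]) : in_L2 leb h ->
  (\esum_(m in [set: Z]) \esum_(n in [set: Z])
     (normc2 (L2inner leb h (gab m n)))%:E = (L2normsq leb h)%:E)%E.
Proof.
move=> hL; rewrite -(parseval basis hL) (esum_lattice uM) esum_esum; last first.
  by move=> m n _ _; rewrite lee_fin addr_ge0 ?sqr_ge0.
rewrite (reindex_esum (setT `*`` (fun=> setT)) setT
  (fun mn : Z * Z => col_mx mn.1 mn.2))//.
split=> //.
- by move=> [m n] [m' n'] _ _ /= /eq_col_mx[-> ->].
- by move=> z _; exists (usubmx z, dsubmx z); rewrite ?vsubmxK.
Qed.

(** In Parseval for [vv m] only block [m] survives, and there the coefficients are those of [ff]; so
    block [m] of [ff] has energy |Q m| / N. Summing over [m] with Parseval for [ff] gives |S|. *)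
Let block_measure :
  (\esum_(m in [set: Z]) lebesgue (Q m) = (N%:R)%:E * lebesgue S)%E.
Proof.
have Q_fin m : (lebesgue (Q m) < +oo)%E.
  by apply: le_lt_trans S_fin; apply: lebesgue_le => x [].
have QE m : lebesgue (Q m) = (N%:R%:E * \esum_(n in [set: Z])
    (normc2 (L2inner leb ff (gab m n)))%:E)%E.
  have := parseval_gab (vvL m).
  rewrite (esum_single (i0 := m)) => [||m' m'm].
  - under eq_esum do rewrite -inner_ff.
    move=> ->; rewrite normsq_vv -EFinM mulrC divfK// fineK//.
    by rewrite ge0_fin_numE.
  - by apply: esum_ge0 => n _; rewrite lee_fin addr_ge0 ?sqr_ge0.
  apply: esum1 => n _; rewrite vv_orth; last by rewrite eq_sym.
  by rewrite /normc2 /= expr0n addr0.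
under eq_esum do rewrite QE.
rewrite esumZl//; last first.
  by move=> m; apply: esum_ge0 => n _; rewrite lee_fin addr_ge0 ?sqr_ge0.
by rewrite (parseval_gab ffL) normsq_ff fineK// ge0_fin_numE.
Qed.

Lemma integral_lattice_count_block :
  (\int[leb]_(x in S) lattice_count A K x = (N%:R)%:E * lebesgue S)%E.
Proof.
rewrite -block_measure.
have -> : lattice_count A K = fun x => \esum_(m in [set: Z]) (\1_(KA m) x : R)%:E.
  apply/funext => x; rewrite /lattice_count.
  (* The count adds lattice points while [KA m] subtracts them, hence the reindexing by negation. *)
  rewrite -(esum_lattice_opp A (fun y => (\1_K y : R)%:E)).
  by [].
have ge0 m x : (0 <= (\1_(KA m) x : R)%:E)%E by rewrite lee_fin indicE.
have mind m : measurable_fun S (fun x => (\1_(KA m) x : R)%:E).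
  by apply/measurable_EFinP; apply: measurable_funTS; exact: measurable_indic.
rewrite (integral_esum leb mS ge0 mind).
by apply: eq_esum => m _; rewrite integral_indic// setIC.
Qed.

End Block.

(** On one translated cell, the count and the constant N have the same integral over every
    measurable subset [S], so they agree almost everywhere there; countably many such cells cover
    the space. *)
Lemma gabor_level_A :
  {ae leb, forall x, lattice_count A K x = (N%:R)%:E}.
Proof.
pose cell z : set X := [set x | lattice_cell T (x - lattice_pt T z)].
have mcell z : measurable (cell z).
  rewrite -[X in measurable X]setTI.
  exact: (measurable_shift (- lattice_pt T z) measurableT (measurable_lattice_cell T)).
have cell_fin z : (lebesgue (cell z) < +oo)%E.
  by rewrite lebesgue_shift; exact: lattice_cell_fin.
have mcount := measurable_lattice_count A mK.
have ae z : ae_eq leb (cell z) (cst (N%:R)%:E) (lattice_count A K).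
  apply: integral_ae_eq.
  - exact: mcell.
  - apply/integrableP; split; first exact: measurable_cst.
    rewrite (eq_integral (cst (N%:R)%:E)) => [|x _]; last by rewrite /= ger0_norm.
    rewrite integral_cst; last exact: mcell.
    by apply: lte_mul_pinfty; [rewrite lee_fin|by []|exact: cell_fin].
  - exact: measurable_funTS.
  move=> S Scell mS; rewrite (integral_lattice_count_block mS Scell).
  by rewrite integral_cst.
have bad z : lebesgue (cell z `&` [set x | lattice_count A K x <> (N%:R)%:E]) = 0%E.
  have [E [mE E0 ES]] := ae z; apply: lebesgue_null_sub E0 => x [cx nx].
  by apply: ES => /= H; apply: nx; rewrite -H.
apply/negligible_lebesgueP; rewrite -(lebesgue_null_bigcup bad).
congr (lebesgue _); apply/seteqP; split=> [x nx|x [z _ []]//].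
exists (lattice_floor T x) => //; split => //=.
exact: lattice_cell_frac.
Qed.

End GaborTiling.

Theorem lemma1p3 (R : realType) (d : nat) (K : set 'cV[R]_d)
    (A B C : 'M[R]_d) (M : 'M[R]_(d + d)) :
  measurable K -> (0 < lebesgue K)%E -> (lebesgue K < +oo)%E ->
  M = block_mx A 0 C B -> M \in unitmx -> `|\det (A *m B)| = 1 ->
  gabor_orthonormal_basis (normalized_indicator K) (lattice M) ->
  exists N : nat, [/\ (1 <= N)%N,
    exists D : 'I_N -> set 'cV[R]_d,
      [/\ forall j, ae_fundamental_domain (lattice (invmx B)^T) (D j),
          forall i j, i != j -> lebesgue (D i `&` D j) = 0%E
        & ae_eq_set K (\bigcup_j D j)],
    exists E : 'I_N -> set 'cV[R]_d,
      [/\ forall j, ae_fundamental_domain (lattice A) (E j),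
          forall i j, i != j -> lebesgue (E i `&` E j) = 0%E
        & ae_eq_set K (\bigcup_j E j)],
    multi_tiles K (lattice (invmx B)^T) N
    & multi_tiles K (lattice A) N].
Proof.
move=> mK K0 Koo ME uM _ basis; subst M.
have /andP[uA uB] : (A \in unitmx) && (B \in unitmx).
  by move: uM; rewrite !unitmxE det_lblock unitrM.
have uT : (invmx B)^T \in unitmx by rewrite unitmx_tr unitmx_inv.
have [N [N0 levelB]] := gabor_level mK K0 Koo uB uM basis.
have levelA := gabor_level_A mK K0 Koo uB uM basis N0 levelB.
have tilesB : multi_tiles K (lattice (invmx B)^T) N.
  exact/(multi_tiles_countE uT).
have tilesA : multi_tiles K (lattice A) N by exact/(multi_tiles_countE uA).
exists N; split => //.
- exact: (multi_tiles_decomposition uT mK tilesB).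
- exact: (multi_tiles_decomposition uA mK tilesA).
Qed.
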